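(* Let $\alpha\ge1$, let $\mathcal{Y}$ be a measurable space, $Y_1,\dots,Y_n\in\mathcal{Y}$ independent random variables, $Y=(Y_1,\dots,Y_n)$, and let $f:\mathcal{Y}^n\to\mathbb{R}$ be measurable. For $i\in[n]$ set $$U_i=\big\|f_i(Y)\mid\mathscr{F}_{-i}\big\|_{\psi_\alpha},\qquad\sigma_i^2=\mathbb{E}\big[f_i^2(Y)\mid\mathscr{F}_{-i}\big],$$ and let the following inequalities hold almost surely for some constants $U\ge K>0$, $\sigma>0$: $$\max_kU_k\le K\le U,\qquad\sum_kU_k^2\le U^2,\qquad\sum_k\sigma_k^2\le\sigma^2.$$ Let $z=\left(4\,\underline{\log}\frac{eU}{\sigma}\right)^{1/\alpha}$. Then for any $\mathrm{x}>0$, with probability at least $1-e^{-\mathrm{x}}$, $$f(Y)-\mathbb{E}f(Y)\le\sigma\sqrt{2\mathrm{x}\frac{n+1}{n}}+\frac{4Kz\,\mathrm{x}}{\min\left\{2\alpha z^\alpha,\ \underline{\log}\left(\left(\frac{Kz}{\sigma\frac{n+1}{n}}\right)^2\mathrm{x}\right)\right\}}.$$ Moreover, with probability at least $1-e^{-\mathrm{x}}$, $$f(Y)-\mathbb{E}f(Y)\le\sigma\sqrt{2\mathrm{x}\frac{n+1}{n}}+\frac34Kz\,\mathrm{x}\,\frac{n+1}{n}.$$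
   Context: $[n]=\{1,\dots,n\}$, $\underline{\log}\,x=\max(\ln x,1)$. $Y'=(Y_1',\dots,Y_n')$ is an independent copy of $Y$ (same distribution), and $\mathbb{E}'$ is expectation with respect to $Y'$. For $y\in\mathcal{Y}^n$, $$f_i(y)=f(y)-\mathbb{E}'f(y_1,\dots,y_{i-1},Y_i',y_{i+1},\dots,y_n)$$ (these expectations being understood to be well defined). $\mathscr{F}_{-i}=\sigma(Y_1,\dots,Y_{i-1},Y_{i+1},\dots,Y_n)$. With $\psi_\alpha(x)=e^{x^\alpha}-1$ ($x\ge 0$), the Orlicz norm of a real random variable $X$ is $\|X\|_{\psi_\alpha}=\inf\{t>0:\mathbb{E}\,\psi_\alpha(|X|/t)\le1\}\in[0,\infty]$. For a sub-$\sigma$-algebra $\mathscr{G}$, the conditional Orlicz norm $\|X\mid\mathscr{G}\|_{\psi_\alpha}$ is the $\mathscr{G}$-measurable random variable $\omega\mapsto\|\mu_{X|\mathscr{G}}(\omega)\|_{\psi_\alpha}$, where $\mu_{X|\mathscr{G}}$ is the regular conditional distribution of $X$ given $\mathscr{G}$ and the norm of a probability measure is that of a random variable with this law. *)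

(* Defs.v *)
From HB Require Import structures.
From mathcomp Require Export all_boot all_order all_algebra.
From mathcomp Require Export all_classical all_reals all_analysis.
From mathcomp Require Export measurable_realfun.

Set Implicit Arguments.
Unset Strict Implicit.
Unset Printing Implicit Defensive.

Import Order.TTheory GRing.Theory Num.Theory.
Import numFieldNormedType.Exports.

Local Open Scope classical_set_scope.
Local Open Scope ring_scope.

Definition ln1 (R : realType) (x : R) : R := Num.max (ln x) 1.

Definition orlicz_psi (R : realType) (alpha x : R) : R :=
  expR (x `^ alpha) - 1.

(* The infimum is taken in \bar R, so that the norm is +oo when no t works. *)
Definition orlicz_norm (R : realType) (alpha : R) (d : measure_display)
    (T : measurableType d) (P : {measure set T -> \bar R}) (X : T -> R) :
    \bar R :=
  ereal_inf [set t%:E | t in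
    [set t : R | 0 < t /\
      (\int[P]_w (orlicz_psi alpha (`|X w| / t))%:E <= 1)%E]].

(* In the next three definitions G is a sub-sigma-algebra of that of Omega, and
   [g_sigma_algebraType G] is Omega equipped with G. *)

(* kappa is a regular conditional distribution of X given G; the law kappa w
   depends on w in a G-measurable way because kappa is a kernel from (Omega, G). *)
Definition is_cond_distribution (R : realType) (d : measure_display)
    (Omega : measurableType d) (P : probability Omega R)
    (G : set (set Omega)) (X : Omega -> R)
    (kappa : R.-pker (g_sigma_algebraType G) ~> R) : Prop :=
  forall (A : set Omega) (B : set R),
    G.-sigma.-measurable A -> measurable B ->
    (\int[P]_(w in A) kappa w B = P (A `&` X @^-1` B))%E.

(* Conditional objects are only defined up to null sets: U is a version of the
   conditional Orlicz norm of X given G. *)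
Definition is_cond_orlicz_norm (R : realType) (d : measure_display)
    (Omega : measurableType d) (P : probability Omega R) (alpha : R)
    (G : set (set Omega)) (X : Omega -> R) (U : Omega -> \bar R) : Prop :=
  exists2 kappa : R.-pker (g_sigma_algebraType G) ~> R,
    is_cond_distribution P X kappa &
    forall w, U w = orlicz_norm alpha (kappa w) idfun.

(* Z is a version of the conditional expectation given G of the nonnegative
   random variable X, with values in [0, +oo]. *)
Definition is_cond_expectation_ge0 (R : realType) (d : measure_display)
    (Omega : measurableType d) (P : probability Omega R)
    (G : set (set Omega)) (X : Omega -> R) (Z : Omega -> \bar R) : Prop :=
  [/\ measurable_fun setT (Z : g_sigma_algebraType G -> \bar R),
      (forall w, 0 <= Z w)%E &
      forall A : set Omega, G.-sigma.-measurable A ->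
        (\int[P]_(w in A) Z w = \int[P]_(w in A) (X w)%:E)%E].

Section random_vector.
Context (R : realType) (d dY : measure_display) (Omega : measurableType d)
  (T : measurableType dY) (P : probability Omega R) (n : nat).
Implicit Types (Y : 'I_n -> {RV P >-> T}) (f : n.-tuple T -> R)
  (y : n.-tuple T) (i : 'I_n).

Definition mutually_independent Y : Prop :=
  forall (J : {set 'I_n}) (B : 'I_n -> set T),
    (forall j, j \in J -> measurable (B j)) ->
    (P (\bigcap_(j in [set` J]) (Y j @^-1` B j)) =
     \prod_(j in J) P (Y j @^-1` B j))%E.

Definition random_vector Y (w : Omega) : n.-tuple T := [tuple Y i w | i < n].

Definition set_coord y i (u : T) : n.-tuple T :=
  [tuple if j == i then u else tnth y j | j < n].

(* f(y_1, ..., Y_i', ..., y_n) involves the independent copy only through the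
   law of Y_i', which is that of Y_i; so the expectation with respect to Y' is
   the P-expectation in which Y_i takes the place of Y_i' and y is fixed. *)
Definition coord_diff Y f i y : R :=
  f y - fine ('E_P[fun w' => f (set_coord y i (Y i w'))]).

Definition coord_mean_defined Y f i y : Prop :=
  P.-integrable [set: Omega] (fun w' => (f (set_coord y i (Y i w')))%:E).

Definition sigma_except Y i : set (set Omega) :=
  <<s \bigcup_(j in [set j | j != i])
        preimage_set_system [set: Omega] (Y j) measurable >>.

End random_vector.

(* Main.v *)
(* The entropy method. Let [phi x = x e^x - e^x + 1]. Integrating out one
   coordinate after the other and applying Young's inequality at each step shows
   that, for [g = e^(l f)] and [F = E g],
     [E (g ln g) - F ln F <= E (g sum_k E_k phi (l f_k))],
   where [E_k] integrates the k-th coordinate and [f_k = f - E_k f]; here [f] is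
   clipped to be bounded, and [phi] is replaced by the convex majorant [Phi], for
   which clipping only decreases the right-hand side. With [b = K z] and
   [z^alpha = 4 ln1 (e U / sigma)], each [E_k Phi (l f_k)] splits at the level [b]:
   below it the variance is used, above it the Orlicz norm, whose contribution is
   damped by [e^(- z^alpha / 2) <= (sigma / (e U))^2]. Summing over [k] gives
     [sum_k E_k Phi (l f_k) <= l^2 sigma^2 e^(3 l b / 2) / 2]
   for [l b <= alpha z^alpha / 2]. Herbst's argument turns this into bounds on
   [ln E e^(l (f - E f))]: with [e^(3 l b / 2) <= (1 - 3 l b / 4)^-2] it yields the
   second inequality, and with [l b] a quarter of the minimum in its denominator,
   the first one. *)

(* A priori nothing makes [e^(l f)] integrable, which is why the entropy argument runs on a clipped
   [f]. The clipping level [M] enters no estimate, so Fatou's lemma can remove it at the end. The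
   difficulty is that the hypotheses concern [f_k], and a centred clipped coordinate is not
   dominated pointwise by [f_k], since clipping also moves the mean. Only expectations of convex
   functions can be compared.

   The conditional hypotheses are almost sure statements about arbitrary versions and kernels. They
   are first converted, for almost every [w], into bounds on integrals over the [k]-th coordinate
   with the others fixed at [Y w]; from then on each coordinate is a problem in one real
   variable. *)
Require Import Defs.
From HB Require Import structures.
From mathcomp Require Import ring lra.

Set Implicit Arguments.
Unset Strict Implicit.
Unset Printing Implicit Defensive.

Import Order.TTheory GRing.Theory Num.Theory.
Import numFieldNormedType.Exports.

Local Open Scope classical_set_scope.
Local Open Scope ring_scope.

(** * Real inequalities *)

Section real_inequalities.
Variable R : realType.
Implicit Types x y s u : R.

(* A convex majorant of [x e^x - e^x + 1], which bounds the entropy of [e^X] for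
   centred [X]; convexity is what lets it survive clipping. *)
Definition Phi x : R := x ^+ 2 / 2 * expR (Num.max x 0).

Definition dPhi x : R := (x + Num.max x 0 ^+ 2 / 2) * expR (Num.max x 0).

Lemma Phi_ge0 x : 0 <= Phi x.
Proof. by rewrite /Phi mulr_ge0 ?expR_ge0 ?divr_ge0 ?sqr_ge0. Qed.

(** Convexity in subgradient form, as [clip_convex_order] takes it. For [x, y >= 0], bounding
    [e^(y - x)] below by [1 + (y - x)] leaves the remainder [(y - x)^2 (1 + x + y) / 2]. *)
Lemma Phi_tangent x y : Phi x + dPhi x * (y - x) <= Phi y.
Proof.
rewrite /Phi /dPhi; have [y0|y0] := leP 0 y; have [x0|x0] := leP 0 x.
- have -> : expR y = expR x * expR (y - x) by rewrite -expRD addrC subrK.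
  have ex := expR_gt0 x.
  suff : x ^+ 2 / 2 + (x + x ^+ 2 / 2) * (y - x) <= y ^+ 2 / 2 * expR (y - x).
    by rewrite -(ler_pM2l ex); lra.
  have : y ^+ 2 / 2 * (1 + (y - x)) <= y ^+ 2 / 2 * expR (y - x).
    by rewrite ler_wpM2l ?expR_ge1Dx// divr_ge0// sqr_ge0.
  apply: le_trans; have : 0 <= (y - x) ^+ 2 * (1 + x + y) by rewrite mulr_ge0 ?sqr_ge0//; lra.
  lra.
- rewrite expR0; have : 1 <= expR y by rewrite -expR0 ler_expR.
  by move=> ?; have := sqr_ge0 (y - x); have := sqr_ge0 y; nra.
- rewrite expR0; have e0 := expR_gt0 x.
  have : 0 <= (x + x ^+ 2 / 2) * expR x * (- y).
    apply: mulr_ge0; last by lra.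
    by apply: mulr_ge0; [rewrite addr_ge0// divr_ge0// sqr_ge0|exact: ltW].
  have : 0 <= expR x * (x ^+ 2 / 2 + x ^+ 3 / 2).
    by rewrite mulr_ge0 ?expR_ge0// addr_ge0// divr_ge0// exprn_ge0.
  have := sqr_ge0 y; nra.
- by rewrite expR0; have := sqr_ge0 (y - x); nra.
Qed.

Lemma dPhi_homo : {homo dPhi : x y / x <= y}.
Proof.
move=> x y; rewrite le_eqVlt => /predU1P[->//|xy].
have := Phi_tangent x y; have := Phi_tangent y x; nra.
Qed.

Lemma expR_quadratic x : 0 <= x -> 1 + x + x ^+ 2 / 2 <= expR x.
Proof.
move=> x0; pose g := fun t : R => expR t - (1 + t + t ^+ 2 / 2).
have dg (t : R) : is_derive t 1 g (expR t - (0 + 1 + t)).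
  by apply: is_deriveB; apply: is_deriveD => //; apply: is_derive_eq; rewrite /GRing.scale/=; lra.
have : g 0 <= g x.
  apply: (@ger0_derive1_ndecry _ g 0) => [t _|t t0||//|//].
  - by case: (dg t).
  - by rewrite derive1E (@derive_val _ _ _ _ _ _ _ (dg t)); have := expR_ge1Dx t; lra.
  - apply: continuous_subspaceT => t; apply: differentiable_continuous.
    by apply/derivable1_diffP; case: (dg t).
by rewrite /g expR0; lra.
Qed.

(** For [x >= 0], after division by [e^x], this follows from [(1 + x + x^2/2) (1 - x + x^2/2) = 1 +
    x^4/4]. For [x < 0] the difference of the two sides has derivative [x (1 - e^x)]; monotonicity
    is applied to its reflection in [0]. *)
Lemma entropy_le_Phi x : x * expR x - expR x + 1 <= Phi x.
Proof.
rewrite /Phi; have [x0|x0] := leP 0 x.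
  suff : 1 <= expR x * (1 - x + x ^+ 2 / 2) by lra.
  have := expR_quadratic x0 => h.
  have h2 : 0 < 1 - x + x ^+ 2 / 2 by have := sqr_ge0 (x - 1); nra.
  have := ler_wpM2r (ltW h2) h; have := sqr_ge0 (x ^+ 2); lra.
rewrite expR0; pose g := fun t : R => t ^+ 2 / 2 - (t * expR t - expR t + 1).
have dg (t : R) : is_derive t 1 g (t * (1 - expR t)).
  by apply: is_derive_eq; rewrite /GRing.scale/=; lra.
have : g 0 <= g x.
  rewrite -(opprK x); set q := - x; have q0 : 0 <= q by rewrite oppr_ge0 ltW.
  have dgN (t : R) : is_derive t 1 (g \o -%R) (t * (1 - expR (- t))).
    by apply: is_derive_eq; rewrite /GRing.scale/=; lra.
  have := @ger0_derive1_ndecry _ (g \o -%R) 0.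
  move=> /(_ _ _ _ 0 q) /=; rewrite oppr0; apply => [t _|t||//|//].
  - by case: (dgN t).
  - rewrite in_itv/= andbT => t0.
    rewrite derive1E (@derive_val _ _ _ _ _ _ _ (dgN t)) mulr_ge0 ?(ltW t0)//.
    by rewrite subr_ge0 -expR0 ler_expR oppr_le0 ltW.
  - apply: continuous_subspaceT => t; apply: differentiable_continuous.
    by apply/derivable1_diffP; case: (dgN t).
by rewrite /g expR0; lra.
Qed.

(** Bernoulli's inequality with a real exponent: [ln y >= 1 - 1/y] gives
    [y^(a-1) >= 1 + (a-1) (1 - 1/y)], and multiplication by [y] yields exactly the claim. *)
Lemma powR_ge1Dx (a y : R) : 1 <= a -> 1 <= y -> 1 + a * (y - 1) <= y `^ a.
Proof.
move=> a1 y1; have y0 : 0 < y by lra.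
have -> : y `^ a = y * y `^ (a - 1).
  rewrite -[X in X * _](powRr1 (ltW y0)) -powRD ?subrKC//.
  by rewrite (gt_eqF y0) implybT.
have -> : y `^ (a - 1) = expR ((a - 1) * ln y) by rewrite /powR gt_eqF.
have : 1 - y^-1 <= ln y.
  have := expR_ge1Dx (- ln y); rewrite expRN lnK ?posrE//; lra.
have a10 : 0 <= a - 1 by lra.
move=> /(ler_wpM2l a10) h.
have h2 : 1 + (a - 1) * (1 - y^-1) <= expR ((a - 1) * ln y).
  by apply: le_trans (expR_ge1Dx _); lra.
apply: le_trans (ler_wpM2l (ltW y0) h2).
have : y * y^-1 = 1 by rewrite divff// gt_eqF.
nra.
Qed.

(** [256 = 8^2 * 4] is the constant met in [sqr_mul_le_expR]. Steps of [1 / 10] are fine enough, as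
    [(11/10)^60] is about [304]; from [e >= 2] one would get only [64]. *)
Lemma expR6_ge : 256 <= expR 6 :> R.
Proof.
have -> : 6 = 60%:R * (1 / 10) :> R by lra.
rewrite expRM_natl; have := expR_ge1Dx (1 / 10 : R) => h.
have : (11 / 10) ^+ 60 <= expR (1 / 10) ^+ 60 :> R by rewrite ler_pXn2r ?nnegrE ?expR_ge0//; lra.
by apply: le_trans; lra.
Qed.

(** [t^2 (t - 4) e^(- t / 2)] is largest at [t = 8]. Each factor is bounded by an exponential
    tangent to it there, [t <= 8 e^(t/8 - 1)] and [t - 4 <= 4 e^(t/4 - 2)], and the exponents add up
    to [t/2 - 4]. *)
Lemma sqr_mul_le_expR (t : R) : 4 <= t -> t ^+ 2 * (t - 4) <= expR 2 * expR (t / 2).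
Proof.
move=> t4; have h1 : t <= 8 * expR (t / 8 - 1) by have := expR_ge1Dx (t / 8 - 1); lra.
have h2 : t - 4 <= 4 * expR (t / 4 - 2).
  by have := expR_ge1Dx (t / 4 - 2); lra.
have : t ^+ 2 * (t - 4) <= (8 * expR (t / 8 - 1)) ^+ 2 * (4 * expR (t / 4 - 2)).
  by rewrite ler_pM ?sqr_ge0// ?subr_ge0// ler_pXn2r ?nnegrE//; lra.
move=> /le_trans; apply.
have -> : (8 * expR (t / 8 - 1)) ^+ 2 * (4 * expR (t / 4 - 2)) =
    256 * (expR (t / 8 - 1) * expR (t / 8 - 1) * expR (t / 4 - 2)) by ring.
rewrite -!expRD.
have -> : t / 8 - 1 + (t / 8 - 1) + (t / 4 - 2) = 2 + t / 2 - 6 by lra.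
rewrite expRB mulrCA ger_pMr ?expR_gt0// ler_pdivrMr ?expR_gt0// mul1r.
exact: expR6_ge.
Qed.

(* [b = K z] is the level above which the Orlicz tail, rather than the
   variance, controls the exponential moment. *)
Lemma sqr_expR_le (alpha tau K c s x : R) : 1 <= alpha -> 4 <= tau ->
  0 < c -> c <= K -> 0 <= s ->
  let u := s * (K * tau `^ alpha^-1) in
  u <= alpha * tau / 2 ->
  x ^+ 2 * expR (Num.max (s * x) 0) <=
  expR u * (x ^+ 2 + u / 4 * expR (2 - tau / 2) * c ^+ 2 * expR ((`|x| / c) `^ alpha)).
Proof.
move=> a1 t4 c0 cK s0 u uat; have a0 : 0 < alpha by lra.
set z := tau `^ alpha^-1 in u uat *.
have z1 : 1 <= z.
  have -> : 1 = 1 `^ alpha^-1 :> R by rewrite powR1.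
  by rewrite ge0_ler_powR ?nnegrE ?invr_ge0 ?ltW//; lra.
have K0 : 0 < K by lra.
have b0 : 0 < K * z by rewrite mulr_gt0//; lra.
have u0 : 0 <= u by rewrite mulr_ge0// ltW.
set b := K * z in u uat u0 b0 *.
have tail0 : 0 <= u / 4 * expR (2 - tau / 2) * c ^+ 2 * expR ((`|x| / c) `^ alpha).
  rewrite mulr_ge0 ?expR_ge0// mulr_ge0 ?sqr_ge0// mulr_ge0 ?expR_ge0//.
  by rewrite divr_ge0.
have [xb|bx] := leP x b.
  apply: (@le_trans _ _ (x ^+ 2 * expR u)).
    rewrite ler_wpM2l ?sqr_ge0// ler_expR ge_max u0 andbT.
    by rewrite ler_wpM2l.
  by rewrite mulrC ler_wpM2l ?expR_ge0// lerDl.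
have x0 : 0 < x by lra.
rewrite (ger0_norm (ltW x0)) max_l ?(mulr_ge0 s0 (ltW x0))//.
set y := x / b; have xE : x = b * y by rewrite /y mulrC divfK ?gt_eqF.
have y1 : 1 <= y by rewrite /y ler_pdivlMr// mul1r ltW.
set w := x / c; have xc : x = w * c by rewrite /w divfK ?gt_eqF.
have wzy : z * y <= w.
  rewrite /w ler_pdivlMr// xE /b.
  have zy : 0 <= z * y by rewrite mulr_ge0//; lra.
  by have := ler_wpM2r zy cK; lra.
have w1 : 1 <= w by apply: le_trans wzy; nra.
set t := w `^ alpha.
have zt : z `^ alpha = tau by rewrite -powRrM mulVf ?gt_eqF// powRr1//; lra.
have tauy : tau * y `^ alpha <= t.
  rewrite -zt -powRM; [|lra|lra].
  by rewrite ge0_ler_powR ?nnegrE ?(ltW a0)//; [rewrite mulr_ge0//; lra|lra].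
have yya : y <= y `^ alpha by rewrite -{1}(powRr1 (_ : 0 <= y)) ?ler_powR//; lra.
have bern := powR_ge1Dx a1 y1.
have wt : w <= t by rewrite -{1}(powRr1 (_ : 0 <= w)) ?ler_powR//; lra.
have t4y : 4 * y <= t by apply: le_trans tauy; nra.
have key := sqr_mul_le_expR (_ : 4 <= t).
(* Both [w <= t] and [4 (y - 1) <= t - 4] enter [sqr_mul_le_expR]; the second produces the
   quarter. *)
have {}key : w ^+ 2 * (y - 1) <= expR (2 + t / 2) / 4.
  rewrite ler_pdivlMr// expRD; apply: le_trans (key _); last lra.
  rewrite -mulrA; apply: ler_pM; rewrite ?sqr_ge0//; [nra| |lra].
  by rewrite ler_pXn2r ?nnegrE//; lra.
have sx : s * x = u + u * (y - 1) by rewrite xE /u; lra.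
(* The cap on [u] acts here: Bernoulli gives [alpha (y - 1) <= y^alpha - 1], hence
   [alpha tau (y - 1) / 2 <= (t - tau) / 2], because [t >= tau y^alpha]. *)
have v2 : u * (y - 1) <= (t - tau) / 2.
  have : u * (y - 1) <= alpha * tau / 2 * (y - 1) by rewrite ler_wpM2r//; lra.
  nra.
have ev : expR (u * (y - 1)) - 1 <= u * (y - 1) * expR (u * (y - 1)).
  have := expR_ge1Dx (- (u * (y - 1))); rewrite expRN => h.
  have := ler_wpM2l (expR_ge0 (u * (y - 1))) h.
  by rewrite divff ?gt_eqF ?expR_gt0//; lra.
rewrite sx expRD mulrCA ler_wpM2l ?expR_ge0//.
suff : w ^+ 2 * (expR (u * (y - 1)) - 1) <= u / 4 * expR (2 - tau / 2) * expR t.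
  have -> : x ^+ 2 = w ^+ 2 * c ^+ 2 by rewrite xc exprMn.
  move=> /(ler_wpM2r (sqr_ge0 c)); move: (expR _) (expR t) (expR _) (w ^+ 2) => e1 e2 e3 w2.
  clear; clearbody u; nra.
(* The weight [e^t] is spent in halves: [e^((t - tau) / 2)] covers [e^(u (y - 1))], and
   [e^(2 + t / 2)] covers the polynomial factor. What remains is the damping [e^(2 - tau / 2)]. *)
apply: (@le_trans _ _ (w ^+ 2 * (u * (y - 1) * expR ((t - tau) / 2)))).
  rewrite ler_wpM2l ?sqr_ge0//; apply: le_trans ev _.
  by rewrite ler_wpM2l ?ler_expR// mulr_ge0//; lra.
have -> : w ^+ 2 * (u * (y - 1) * expR ((t - tau) / 2)) =
  w ^+ 2 * (y - 1) * (u * expR ((t - tau) / 2)) by ring.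
apply: (le_trans (ler_wpM2r _ key)); first by rewrite mulr_ge0// expR_ge0.
have -> : expR (2 + t / 2) / 4 * (u * expR ((t - tau) / 2)) =
  u / 4 * (expR (2 + t / 2) * expR ((t - tau) / 2)) by lra.
rewrite -expRD -[leRHS]mulrA -expRD.
by rewrite (_ : 2 + t / 2 + (t - tau) / 2 = 2 - tau / 2 + t)//; lra.
Qed.

(* Young's inequality [e^a b <= a e^a - e^a + e^b] for [b = ln (q / H)]. *)
Lemma Phi_young (a q H : R) : 0 < q -> 0 < H ->
  expR a * (ln q - ln H) <= Phi a + (H^-1 * q - 1).
Proof.
move=> q0 H0; set b := ln q - ln H.
have -> : H^-1 * q = expR b by rewrite /b expRB !lnK ?posrE// mulrC.
have := entropy_le_Phi a; have := expR_ge1Dx (b - a); rewrite expRB.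
move=> /(ler_wpM2l (expR_ge0 a)); rewrite mulrCA divff ?mulr1 ?gt_eqF ?expR_gt0//.
by move: (expR a) (expR b) (Phi a) => e1 e2 e3; nra.
Qed.

(** [l] and [l'] stand for the logarithmic moment generating function at [s] and [s'], and [c] for
    its slope at [s]. As [1 - B s = rho s], the entropy bound becomes [v / (2 rho^2)]; the tangent
    inequality is multiplied by [rho' + B], where [(s' - s) (rho' + B) = - (rho' - rho) s]. *)
Lemma herbst_algebra (v B rho rho' c F l l' : R) :
  0 <= B -> 0 < rho -> rho <= rho' -> 0 < F ->
  let s := (rho + B)^-1 in let s' := (rho' + B)^-1 in
  s * (c * F) - F * l <= v * s ^+ 2 / (2 * (1 - B * s) ^+ 2) * F ->
  l + (s' - s) * c <= l' ->
  l * (rho + B) <= l' * (rho' + B) + (rho' - rho) * (v / 2 / rho ^+ 2).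
Proof.
move=> B0 rho0 rr F0 s s' en tg.
have rB : 0 < rho + B by rewrite ltr_wpDr.
have rB' : 0 < rho' + B by rewrite ltr_wpDr// (lt_le_trans rho0).
have sE : s * (rho + B) = 1 by rewrite mulVf ?gt_eqF.
have sE' : s' * (rho' + B) = 1 by rewrite mulVf ?gt_eqF.
have s0 : 0 < s by rewrite invr_gt0.
clearbody s s'.
have kE : v * s ^+ 2 / (2 * (1 - B * s) ^+ 2) = v / 2 / rho ^+ 2.
  have -> : 1 - B * s = rho * s by rewrite -sE; ring.
  by field; rewrite !gt_eqF.
rewrite {}kE in en; set k := v / 2 / rho ^+ 2 in en *; clearbody k.
have {}en : s * c - l <= k by rewrite -(ler_pM2r F0); lra.
have h1 : (rho' - rho) * (s * c) <= (rho' - rho) * (l + k).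
  by rewrite ler_wpM2l ?subr_ge0//; lra.
have h2 : (l + (s' - s) * c) * (rho' + B) <= l' * (rho' + B) by rewrite ler_pM2r.
have h3 : (s' - s) * c * (rho' + B) = - ((rho' - rho) * (s * c)).
  have -> : (s' - s) * c * (rho' + B) = c * (s' * (rho' + B) - s * (rho' + B)) by ring.
  rewrite sE' -[in LHS]sE; ring.
by rewrite mulrDl h3 in h2; lra.
Qed.

(** The excess over the limit is at most [(C + v / 2) / rho / (m + 1)], because [p >= m + 1] and the
    step ratio exceeds [1] by [1 / (m + 1)]. *)
Lemma herbst_limit (x mu C v rho : R) : 0 <= C -> 0 <= v -> 0 < rho ->
  (forall m : nat, exists2 p, m.+1%:R <= p &
     x <= mu + C / (p * rho) + (1 + m.+1%:R^-1) * (v / 2) * (rho^-1 - (p * rho)^-1)) ->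
  x <= mu + v / 2 / rho.
Proof.
move=> C0 v0 r0 H; apply/ler_addgt0Pr => e e0.
pose D := (C + v / 2) / rho.
have D0 : 0 <= D by rewrite divr_ge0 ?(ltW r0)// addr_ge0// divr_ge0.
have [m mD] : exists m : nat, D / e < m.+1%:R.
  exists (Num.bound (D / e)); apply: lt_trans (archi_boundP (divr_ge0 D0 (ltW e0))) _.
  by rewrite ltr_nat.
have m0 : 0 < m.+1%:R :> R by rewrite ltr0n.
have [p pm xp] := H m; have p0 : 0 < p by apply: lt_le_trans pm.
have mV0 : 0 < m.+1%:R^-1 :> R by rewrite invr_gt0.
have Dm : D * m.+1%:R^-1 <= e.
  by rewrite ler_pdivrMr// mulrC -ler_pdivrMr// ltW.
have rV0 : 0 < rho^-1 by rewrite invr_gt0.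
have Cp : C / (p * rho) <= C * rho^-1 * m.+1%:R^-1.
  rewrite invfM [p^-1 * _]mulrC mulrA ler_wpM2l ?mulr_ge0 ?(ltW rV0)//.
  by rewrite lef_pV2.
have pr0 : 0 <= (p * rho)^-1 by rewrite invr_ge0 mulr_ge0 ?ltW.
move: Dm Cp xp; rewrite /D; move: (m.+1%:R^-1) mV0 (rho^-1) rV0 ((p * rho)^-1) pr0.
move=> mi mi0 ri ri0 pr pr0 Dm Cp xp.
have : (1 + mi) * (v / 2) * (ri - pr) <= (1 + mi) * (v / 2) * ri.
  by rewrite ler_wpM2l ?mulr_ge0 ?divr_ge0//; lra.
by lra.
Qed.

(** Serves the geometric sequences of Herbst's argument: the ratio [1 + 1 / (m + 1)] tends to [1]
    while this power of it still tends to infinity. *)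
Lemma bernoulli_power (m : nat) : m.+1%:R <= (1 + m.+1%:R^-1) ^+ (m.+1 * m.+1) :> R.
Proof.
have h (q : R) k : 0 <= q -> 1 + k%:R * q <= (1 + q) ^+ k.
  move=> q0; elim: k => [|k IH]; first by rewrite mul0r addr0 expr0.
  rewrite exprS; apply: le_trans (ler_wpM2l _ IH); last by rewrite addr_ge0.
  rewrite -natr1; have : 0 <= k%:R * q * q by rewrite !mulr_ge0.
  by lra.
apply: le_trans (h _ _ _); last by rewrite invr_ge0.
by rewrite natrM mulfK ?pnatr_eq0// lerDr.
Qed.

(** The source of the constants in [z]: for [tau = 4 L] the exponent is [2 - 2 L], the [e] inside
    the logarithm gives [L >= 1 + ln (U / sigma)], and the truncation at [1] gives [4 <= tau]. *)
Lemma ln1_tail (U sigma tau : R) : 0 < U -> 0 < sigma ->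
  tau = 4 * ln1 (expR 1 * U / sigma) -> 4 <= tau /\ expR (2 - tau / 2) * U ^+ 2 <= sigma ^+ 2.
Proof.
move=> U0 s0 ->; split.
  have : 1 <= ln1 (expR 1 * U / sigma) by rewrite le_max lexx orbT.
  lra.
set L := ln1 _.
have LE : 1 + ln (U / sigma) <= L.
  have -> : 1 + ln (U / sigma) = ln (expR 1 * U / sigma).
    by rewrite -mulrA [RHS]lnM ?posrE ?expR_gt0 ?divr_gt0// expRK.
  by rewrite le_max lexx.
have e1 : expR (2 - 4 * L / 2) <= expR (- (ln (U / sigma) + ln (U / sigma))).
  by rewrite ler_expR; move: (ln _) L LE => l {}L LE; lra.
have e2 : expR (- (ln (U / sigma) + ln (U / sigma))) * U ^+ 2 = sigma ^+ 2.
  rewrite expRN expRD lnK ?posrE ?divr_gt0//.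
  by field; rewrite !gt_eqF.
by rewrite -e2 ler_wpM2r// sqr_ge0.
Qed.

End real_inequalities.

(** * Means of bounded functions, clipping and one-variable exponential bounds *)

Section bounded_mean.
Context {d} {T : measurableType d} {R : realType}.
Implicit Types u v : T -> R.

(** The bound holds everywhere rather than almost everywhere, so it survives any change of a
    coordinate. *)
Definition bmeas u : Prop :=
  measurable_fun [set: T] u /\ exists M : R, forall x, `|u x| <= M.

Lemma bmeas_cst (c : R) : bmeas (fun=> c).
Proof. by split; [exact: measurable_cst|exists `|c|]. Qed.

Lemma bmeasD u v : bmeas u -> bmeas v -> bmeas (fun x => u x + v x).
Proof.
move=> [mu [M uM]] [mv [N vN]]; split; first exact: measurable_funD.
by exists (M + N) => x; apply: le_trans (ler_normD _ _) (lerD _ _).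
Qed.

Lemma bmeasM u v : bmeas u -> bmeas v -> bmeas (fun x => u x * v x).
Proof.
move=> [mu [M uM]] [mv [N vN]]; split; first exact: measurable_funM.
by exists (M * N) => x; rewrite normrM ler_pM.
Qed.

Lemma bmeasZ (c : R) u : bmeas u -> bmeas (fun x => c * u x).
Proof. by move=> ?; apply: bmeasM => //; exact: bmeas_cst. Qed.

Lemma bmeasN u : bmeas u -> bmeas (fun x => - u x).
Proof.
move=> [mu [M uM]]; split; first exact: measurableT_comp mu.
by exists M => x; rewrite normrN.
Qed.

Lemma bmeasB u v : bmeas u -> bmeas v -> bmeas (fun x => u x - v x).
Proof. by move=> ? ?; apply: bmeasD => //; exact: bmeasN. Qed.

Lemma bmeas_expR u : bmeas u -> bmeas (fun x => expR (u x)).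
Proof.
move=> [mu [M uM]]; split; first exact: measurableT_comp mu.
exists (expR M) => x; rewrite ger0_norm ?expR_ge0// ler_expR.
exact: le_trans (ler_norm _) (uM x).
Qed.

Lemma bmeas_ln u (e : R) : 0 < e -> bmeas u -> (forall x, e <= u x) ->
  bmeas (fun x => ln (u x)).
Proof.
move=> e0 [mu [M uM]] eu; split; first exact: measurableT_comp mu.
exists (Num.max `|ln e| `|ln M|) => x.
have u0 : 0 < u x := lt_le_trans e0 (eu x).
have ux : u x <= M := le_trans (ler_norm _) (uM x).
rewrite ler_norml; apply/andP; split.
  apply: (@le_trans _ _ (ln e)); last by rewrite ler_ln ?posrE.
  by rewrite lerNl (le_trans (ler_norm _))// normrN le_max lexx.
apply: (@le_trans _ _ (ln M)); first by rewrite ler_ln ?posrE// (lt_le_trans u0).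
by rewrite (le_trans (ler_norm _))// le_max lexx orbT.
Qed.

Lemma bmeas_sum n (F : 'I_n -> T -> R) :
  (forall k, bmeas (F k)) -> bmeas (fun x => \sum_(k < n) F k x).
Proof.
elim: n F => [|n IH] F mF.
  rewrite (_ : (fun x => _) = cst 0); first exact: bmeas_cst.
  by apply/funext => x; rewrite big_ord0.
rewrite (_ : (fun x => _) = fun x => \sum_(k < n) F (widen_ord (leqnSn n) k) x + F ord_max x).
  by apply: bmeasD => //; exact: IH.
by apply/funext => x; rewrite big_ord_recr.
Qed.

Variable P : probability T R.

Lemma bmeas_integrable u : bmeas u -> P.-integrable [set: T] (EFin \o u).
Proof.
move=> [mu [M uM]]; apply: measurable_bounded_integrable => //.
  exact: le_lt_trans (probability_le1 P measurableT) (ltry 1).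
exists M; split; first by rewrite num_real.
by move=> x Mx y _; exact: le_trans (uM y) (ltW Mx).
Qed.

Lemma mean_cst (c : R) : \int[P]_x c = c.
Proof. by rewrite Rintegral_cst//= probability_setT mulr1. Qed.

Lemma meanD u v : bmeas u -> bmeas v ->
  \int[P]_x (u x + v x) = \int[P]_x u x + \int[P]_x v x.
Proof. by move=> ? ?; rewrite RintegralD//; exact: bmeas_integrable. Qed.

Lemma meanB u v : bmeas u -> bmeas v ->
  \int[P]_x (u x - v x) = \int[P]_x u x - \int[P]_x v x.
Proof. by move=> ? ?; rewrite RintegralB//; exact: bmeas_integrable. Qed.

Lemma meanZ (c : R) u : bmeas u -> \int[P]_x (c * u x) = c * \int[P]_x u x.
Proof. by move=> ?; rewrite RintegralZl//; exact: bmeas_integrable. Qed.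

Lemma mean_le u v : bmeas u -> bmeas v -> (forall x, u x <= v x) ->
  \int[P]_x u x <= \int[P]_x v x.
Proof. by move=> ? ? uv; apply: le_Rintegral => //; exact: bmeas_integrable. Qed.

Lemma mean_ge (c : R) u : bmeas u -> (forall x, c <= u x) -> c <= \int[P]_x u x.
Proof.
by move=> bu cu; rewrite -[leLHS]mean_cst; apply: mean_le => //; exact: bmeas_cst.
Qed.

Lemma mean_sum n (F : 'I_n -> T -> R) : (forall k, bmeas (F k)) ->
  \int[P]_x (\sum_(k < n) F k x) = \sum_(k < n) \int[P]_x F k x.
Proof.
elim: n F => [|n IH] F mF.
  by rewrite big_ord0; under eq_Rintegral do rewrite big_ord0; rewrite mean_cst.
under eq_Rintegral do rewrite big_ord_recr/=.
by rewrite meanD ?IH ?big_ord_recr//; exact: bmeas_sum.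
Qed.

End bounded_mean.

Section real_integrable.
Context {d} {T : measurableType d} {R : realType} (P : probability T R).
Implicit Types u v : T -> R.

Local Notation integ u := (P.-integrable [set: T] (EFin \o u)).

Lemma integrable_cst (c : R) : integ (fun=> c).
Proof. exact: finite_measure_integrable_cst. Qed.

Lemma integrableBr u v : integ u -> integ v -> integ (fun x => u x - v x).
Proof. by move=> iu iv; have := integrableB measurableT iu iv. Qed.

Lemma integrableDr u v : integ u -> integ v -> integ (fun x => u x + v x).
Proof. by move=> iu iv; have := integrableD measurableT iu iv. Qed.

Lemma integrableZr (c : R) u : integ u -> integ (fun x => c * u x).
Proof. by move=> iu; have := integrableZl measurableT c iu. Qed.

Lemma EFin_mean u : integ u -> (\int[P]_x (u x)%:E = (\int[P]_x u x)%:E)%E.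
Proof. by move=> iu; rewrite /Rintegral fineK//; exact: (integrable_fin_num measurableT). Qed.

Lemma ge0_integrable u : measurable_fun [set: T] u -> (forall x, 0 <= u x) ->
  (\int[P]_x (u x)%:E < +oo)%E -> integ u.
Proof.
move=> mu u0 uoo; apply/integrableP; split; first exact/measurable_EFinP.
by under eq_integral do rewrite /= ger0_norm//.
Qed.

End real_integrable.

Section single_variable.
Context {d} {T : measurableType d} {R : realType} (P : probability T R).
Implicit Types (X : T -> R) (M : R).

Definition clip M (x : R) : R := Num.max (- M) (Num.min x M).

Lemma clip_norm M x : 0 <= M -> `|clip M x| <= M.
Proof.
move=> M0; rewrite ler_norml /clip le_max lexx/= ge_max ge_min lexx orbT andbT.
lra.
Qed.

Lemma measurable_clip M : measurable_fun [set: R] (clip M).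
Proof.
by apply: measurable_maxr => //; apply: measurable_minr.
Qed.

Lemma bmeas_clip d' (S : measurableType d') M (u : S -> R) : 0 <= M ->
  measurable_fun [set: S] u -> bmeas (fun x => clip M (u x)).
Proof.
move=> M0 mu; split; first exact: measurableT_comp (measurable_clip M) mu.
by exists M => x; exact: clip_norm.
Qed.

(* Clipping is nondecreasing and 1-Lipschitz, so it decreases the centred
   variable in the convex order: the excess [X - clip M X] is positively
   correlated with any nondecreasing function of [clip M X]. The level [tau]
   makes this correlation inequality hold pointwise. *)
Lemma clip_convex_order (F p : R -> R) X M :
  (forall x, 0 <= F x) -> measurable_fun [set: R] F ->
  (forall x y, F x + p x * (y - x) <= F y) -> {homo p : x y / x <= y} ->
  0 <= M -> measurable_fun [set: T] X -> P.-integrable [set: T] (EFin \o X) ->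
  (\int[P]_w (F (clip M (X w) - \int[P]_w' clip M (X w')))%:E <=
   \int[P]_w (F (X w - \int[P]_w' X w'))%:E)%E.
Proof.
move=> F0 mF Fp hp M0 mX iX; pose A w := clip M (X w); rewrite -/A.
set a := \int[P]_w' A w'; set m := \int[P]_w' X w'.
have bA : bmeas A by exact: bmeas_clip.
have iA := bmeas_integrable P bA.
pose D w := X w - A w; pose delta := m - a.
have iD : P.-integrable setT (EFin \o D) by exact: integrableBr.
pose tau := if 0 <= delta then p (M - a) else p (- M - a).
have AM w : - M <= A w <= M by rewrite -ler_norml clip_norm.
have Dle w : A w < M -> D w <= 0.
  rewrite /D /A /clip; case: (leP (X w) M) => XM; last by rewrite gt_max ltxx andbF.
  by rewrite subr_le0 le_max lexx orbT.
have Dge w : - M < A w -> 0 <= D w.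
  rewrite /D /A /clip lt_max ltxx/= lt_min => /andP[XM _].
  by rewrite subr_ge0 ge_max (ltW XM) ge_min lexx.
(* If [D w > delta >= 0], then [A w = M], where the slope is [tau] itself; if [D w <= delta], the
   slope is at most [tau] and multiplies a nonpositive number. The case [delta < 0] is symmetric. *)
have tauP w : tau * (D w - delta) <= p (A w - a) * (D w - delta).
  have [/andP[A1 A2]] := AM w.
  rewrite /tau; case: (leP 0 delta) => dl; have [Dd|Dd] := leP (D w) delta.
  - rewrite ler_wnM2r ?subr_le0//; apply: hp; lra.
  - suff -> : A w = M by [].
    apply/eqP; rewrite eq_le A2/= leNgt; apply/negP => /Dle; lra.
  - suff -> : A w = - M by [].
    apply/eqP; rewrite eq_le A1 andbT leNgt; apply/negP => /Dge; lra.
  - rewrite ler_wpM2r ?subr_ge0 ?(ltW Dd)//; apply: hp; lra.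
have pw w : F (A w - a) + tau * (D w - delta) <= F (X w - m).
  apply: le_trans (Fp (A w - a) (X w - m)); rewrite lerD2l.
  by apply: le_trans (tauP w) _; rewrite /D /delta; have -> : X w - A w - (m - a) = X w - m - (A w - a) by lra.
have mF' (u : T -> R) : measurable_fun setT u -> measurable_fun setT (fun w => (F (u w))%:E).
  by move=> mu; apply/measurable_EFinP; exact: measurableT_comp mF mu.
have mAa : measurable_fun setT (fun w => A w - a) by apply: measurable_funB => //; case: bA.
have mXm : measurable_fun setT (fun w => X w - m) by exact: measurable_funB.
have [foo|] := eqVneq (\int[P]_w (F (X w - m))%:E)%E +oo%E; first by rewrite foo leey.
rewrite -ltey => foo.
have iFX : P.-integrable setT (EFin \o (fun w => F (X w - m))).
  by apply: ge0_integrable => //; exact: measurableT_comp mF mXm.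
have iDd : P.-integrable setT (EFin \o (fun w => D w - delta)).
  by apply: integrableBr => //; exact: integrable_cst.
have itau : P.-integrable setT (EFin \o (fun w => tau * (D w - delta))).
  exact: integrableZr.
have iFA : P.-integrable setT (EFin \o (fun w => F (A w - a))).
  have iB := integrableBr iFX itau.
  apply: (le_integrable measurableT _ _ iB); first exact: mF'.
  move=> w _ /=; rewrite lee_fin !ger0_norm//; first by have := pw w; lra.
  by have := pw w; have := F0 (A w - a); lra.
have itau0 : \int[P]_w (tau * (D w - delta)) = 0.
  rewrite RintegralZl// RintegralB//; last exact: integrable_cst.
  by rewrite RintegralB// mean_cst subrr mulr0.
rewrite -[leLHS]adde0.
have <- : (\int[P]_w (tau * (D w - delta))%:E = 0)%E by rewrite EFin_mean// itau0.
rewrite -integralD_EFin//; apply: le_integral => //; first exact: integrableD.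
by move=> w _ /=; rewrite -EFinD lee_fin; exact: pw.
Qed.

Lemma measurable_Phi : measurable_fun [set: R] (@Phi R).
Proof.
apply: measurable_funM; first by apply: measurable_funM => //; exact: exprn_measurable.
by apply: measurableT_comp => //; exact: measurable_maxr.
Qed.

Lemma measurable_orlicz_psi (alpha : R) : measurable_fun [set: R] (orlicz_psi alpha).
Proof.
by apply: measurable_funB => //; apply: measurableT_comp.
Qed.

(** The bound is given only for [t > c], since the infimum defining the norm need not be known to be
    attained. It is carried to [t = c] by monotone convergence along [t = c r^(- 1 / alpha)] with
    [r] increasing to [1], which multiplies the exponent by [r]. *)
Lemma orlicz_expR_le2 (alpha c : R) X : 1 <= alpha -> 0 < c ->
  measurable_fun [set: T] X ->
  (forall t : R, c < t -> (\int[P]_w (orlicz_psi alpha (`|X w| / t))%:E <= 1)%E) ->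
  (\int[P]_w (expR ((`|X w| / c) `^ alpha))%:E <= 2%:E)%E.
Proof.
move=> a1 c0 mX hX; have a0 : 0 < alpha by lra.
pose B w := (`|X w| / c) `^ alpha.
have mB : measurable_fun setT B.
  apply: (measurableT_comp (@measurable_powR R alpha)).
  by apply: measurable_funM => //; exact: measurableT_comp.
have B0 w : 0 <= B w by exact: powR_ge0.
(* [harmonic m.+1] is [1 / (m + 2)]; the shift keeps [r 0 = 1 / 2] positive. *)
pose r (m : nat) : R := 1 - harmonic m.+1.
have r01 m : 0 < r m < 1.
  rewrite /r /harmonic /= subr_gt0 invf_lt1 ?ltr1n// gtrBl invr_gt0 ltr0n.
  by [].
pose g m w := (expR (r m * B w))%:E.
have mg m : measurable_fun setT (g m).
  by apply/measurable_EFinP; apply: measurableT_comp => //; exact: measurable_funM.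
have g2 m : (\int[P]_w g m w <= 2%:E)%E.
  have /andP[r0 r1] := r01 m.
  pose t := c * (r m) `^ (- alpha^-1).
  have ct : c < t.
    rewrite /t ltr_pMr// powRN invf_gt1 ?powR_gt0//.
    have -> : 1 = 1 `^ alpha^-1 :> R by rewrite powR1.
    by rewrite gt0_ltr_powR ?nnegrE ?invr_gt0 ?ler01 ?(ltW r0).
  have tE q : 0 <= q -> (q / t) `^ alpha = r m * (q / c) `^ alpha.
    move=> q0; rewrite /t powRN invfM invrK mulrA powRM ?powR_ge0//; last first.
      by rewrite divr_ge0// ltW.
    by rewrite -(powRrM (r m)) mulVf ?gt_eqF// (powRr1 (ltW r0)) mulrC.
  have gE w : g m w = ((orlicz_psi alpha (`|X w| / t))%:E + 1)%E.
    by rewrite /orlicz_psi tE// -EFinD subrK.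
  under eq_integral do rewrite gE.
  rewrite ge0_integralD//; last 2 first.
  - by move=> w _; rewrite lee_fin subr_ge0 -[X in X <= _]expR0 ler_expR powR_ge0.
  - apply/measurable_EFinP; apply: (measurableT_comp (measurable_orlicz_psi alpha)).
    by apply: measurable_funM => //; exact: measurableT_comp.
  rewrite integral_cst//= probability_setT mule1.
  by rewrite (_ : 2%:E = 1 + 1)%E ?leeD2r// ?hX// -EFinD.
have lim_g : (\int[P]_w g m w)%E @[m --> \oo] -->
    (\int[P]_w (limn (g^~ w)))%E.
  apply: cvg_monotone_convergence => // [m w _|w _ m m' mm'].
    by rewrite lee_fin expR_ge0.
  rewrite lee_fin ler_expR ler_wpM2r// /r lerD2l lerN2 /harmonic /=.
  by rewrite lef_pV2 ?posrE ?ltr0n// ler_nat ltnS ltnS.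
have limgE w : limn (g^~ w) = (expR (B w))%:E.
  apply/cvg_lim => //; apply: cvg_EFin; first exact: nearW.
  have r1 : r m @[m --> \oo] --> (1 : R).
    rewrite -[X in _ --> X]subr0; apply: cvgB; first exact: cvg_cst.
    by have := @cvg_harmonic R; rewrite -(cvg_shiftS).
  have rB : r m * B w @[m --> \oo] --> B w.
    by rewrite -[X in _ --> X]mul1r; apply: cvgMl.
  exact: (cvg_comp (fun m => r m * B w) expR rB (@continuous_expR R (B w))).
under eq_integral do rewrite -limgE.
rewrite -(cvg_lim _ lim_g)//; apply: lime_le; first by apply/cvg_ex; eexists; exact: lim_g.
exact: nearW.
Qed.

(** Integrates [sqr_expR_le]; the Orlicz weight has mean at most [2], which turns [u / 4] into
    [u / 2]. *)
Lemma integral_Phi_le_level (alpha tau K s c s2 : R) X : 1 <= alpha -> 4 <= tau ->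
  0 < c -> c <= K -> 0 <= s ->
  let u := s * (K * tau `^ alpha^-1) in
  u <= alpha * tau / 2 -> measurable_fun [set: T] X ->
  (\int[P]_w (X w ^+ 2)%:E <= s2%:E)%E ->
  (forall t : R, c < t -> (\int[P]_w (orlicz_psi alpha (`|X w| / t))%:E <= 1)%E) ->
  (\int[P]_w (Phi (s * X w))%:E <=
   (s ^+ 2 / 2 * expR u * (s2 + u / 2 * expR (2 - tau / 2) * c ^+ 2))%:E)%E.
Proof.
move=> a1 t4 c0 cK s0 u uat mX X2 hX.
have u0 : 0 <= u.
  by rewrite /u mulr_ge0// mulr_ge0 ?powR_ge0// (le_trans (ltW c0)).
pose k := u / 4 * expR (2 - tau / 2) * c ^+ 2.
have k0 : 0 <= k.
  rewrite /k mulr_ge0 ?sqr_ge0// mulr_ge0 ?expR_ge0// divr_ge0//.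
pose B w := expR ((`|X w| / c) `^ alpha).
have mB : measurable_fun setT B.
  apply: measurableT_comp => //.
  apply: (measurableT_comp (@measurable_powR R alpha)).
  by apply: measurable_funM => //; exact: measurableT_comp.
have mX2 : measurable_fun setT (fun w => X w ^+ 2).
  exact: measurableT_comp (exprn_measurable 2) mX.
have mP : measurable_fun setT (fun w => (Phi (s * X w))%:E).
  apply/measurable_EFinP; apply: (measurableT_comp measurable_Phi).
  exact: measurable_funM.
pose q := s ^+ 2 / 2 * expR u.
have q0 : 0 <= q by rewrite mulr_ge0 ?expR_ge0// divr_ge0// sqr_ge0.
apply: (@le_trans _ _ (\int[P]_w (q%:E * ((X w ^+ 2)%:E + k%:E * (B w)%:E)))%E).
  apply: ge0_le_integral => //.
  - by move=> w _; rewrite lee_fin Phi_ge0.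
  - apply: measurable_funeM; apply: emeasurable_funD; first exact/measurable_EFinP.
    by apply: measurable_funeM; exact/measurable_EFinP.
  - move=> w _; rewrite -[leRHS]/((q * (X w ^+ 2 + k * B w))%:E) lee_fin /Phi.
    have := @sqr_expR_le _ alpha tau K c s (X w) a1 t4 c0 cK s0 uat.
    have s20 : 0 <= s ^+ 2 / 2 by rewrite divr_ge0// sqr_ge0.
    move=> /(ler_wpM2l s20); rewrite -/u -/k -/(B w).
    rewrite /q exprMn; move: (expR u) (expR _) (B w) => e1 e2 e3.
    by rewrite mulrAC [in leRHS]mulrA -[in leRHS]mulrA; nra.
rewrite ge0_integralZl//; last 2 first.
- apply: emeasurable_funD; first exact/measurable_EFinP.
  by apply: measurable_funeM; exact/measurable_EFinP.
- move=> w _; rewrite -[leRHS]/((X w ^+ 2 + k * B w)%:E) lee_fin.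
  by rewrite addr_ge0 ?sqr_ge0// mulr_ge0// expR_ge0.
rewrite [leRHS]EFinM; apply: lee_wpmul2l; first by rewrite lee_fin.
rewrite ge0_integralD//; last 4 first.
- by move=> w _; rewrite lee_fin sqr_ge0.
- exact/measurable_EFinP.
- by move=> w _; rewrite -EFinM lee_fin mulr_ge0// expR_ge0.
- by apply: measurable_funeM; exact/measurable_EFinP.
rewrite ge0_integralZl//; [|exact/measurable_EFinP|by move=> w _; rewrite lee_fin expR_ge0].
rewrite [leRHS]EFinD; apply: leeD => //.
have := orlicz_expR_le2 a1 c0 mX hX.
have k0E : (0 <= k%:E)%E by [].
move=> /(lee_wpmul2l k0E) /le_trans; apply.
by rewrite -EFinM lee_fin /k; lra.
Qed.

(** The pointwise bound divides by the level, so [U = 0] is reached as a limit: every small [c > 0]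
    is then an admissible level, with a tail term of order [c^2]. *)
Lemma integral_Phi_le (alpha tau K s U s2 : R) X : 1 <= alpha -> 4 <= tau ->
  0 <= U -> U <= K -> 0 < K -> 0 <= s ->
  let u := s * (K * tau `^ alpha^-1) in
  u <= alpha * tau / 2 -> measurable_fun [set: T] X ->
  (\int[P]_w (X w ^+ 2)%:E <= s2%:E)%E ->
  (forall t : R, U < t -> (\int[P]_w (orlicz_psi alpha (`|X w| / t))%:E <= 1)%E) ->
  (\int[P]_w (Phi (s * X w))%:E <=
   (s ^+ 2 / 2 * expR u * (s2 + u / 2 * expR (2 - tau / 2) * U ^+ 2))%:E)%E.
Proof.
move=> a1 t4 U0 UK K0 s0 u uat mX X2 hX.
have lvl c : 0 < c -> U <= c -> c <= K -> (\int[P]_w (Phi (s * X w))%:E <=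
    (s ^+ 2 / 2 * expR u * (s2 + u / 2 * expR (2 - tau / 2) * c ^+ 2))%:E)%E.
  move=> c0 Uc cK; apply: integral_Phi_le_level => // t ct; apply: hX.
  exact: le_lt_trans ct.
move: U0; rewrite le_eqVlt => /predU1P[U0|U0]; last exact: lvl.
apply/lee_addgt0Pr => e e0.
pose k := s ^+ 2 / 2 * expR u * (u / 2 * expR (2 - tau / 2)).
have k0 : 0 <= k.
  rewrite /k mulr_ge0//; first by rewrite mulr_ge0 ?expR_ge0// divr_ge0// sqr_ge0.
  rewrite mulr_ge0 ?expR_ge0// divr_ge0//.
  by rewrite /u mulr_ge0// mulr_ge0 ?powR_ge0// ltW.
have kK : 0 < k * K + 1 by rewrite ltr_wpDl// mulr_ge0// ltW.
(* Ensures [k c^2 <= k c K <= e]; the [+ 1] keeps the denominator positive. *)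
pose c := Num.min K (e / (k * K + 1)).
have c0 : 0 < c by rewrite lt_min K0 divr_gt0.
have cK : c <= K by rewrite ge_min lexx.
apply: le_trans (lvl c c0 _ cK) _; first by rewrite -U0 ltW.
rewrite -U0 -EFinD lee_fin.
have : k * c ^+ 2 <= e.
  have : c * (k * K + 1) <= e by rewrite -ler_pdivlMr// ge_min lexx orbT.
  have : k * c ^+ 2 <= k * c * K by rewrite expr2 mulrA ler_wpM2l// mulr_ge0// ltW.
  by lra.
by rewrite /k; lra.
Qed.

End single_variable.

(** * Resampling coordinates of an independent vector *)

Section law_equality.
Context {d1 d2 d3 : measure_display} {X1 : measurableType d1}
  {X2 : measurableType d2} {S : measurableType d3} {R : realType}.
Variables (m1 : {measure set X1 -> \bar R}) (m2 : {measure set X2 -> \bar R}).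
Variables (f1 : X1 -> S) (f2 : X2 -> S).
Hypotheses (mf1 : measurable_fun [set: X1] f1) (mf2 : measurable_fun [set: X2] f2).

Lemma eq_law_integral (F : S -> \bar R) :
  (forall A, measurable A -> m1 (f1 @^-1` A) = m2 (f2 @^-1` A)) ->
  measurable_fun [set: S] F -> (forall y, 0 <= F y)%E ->
  (\int[m1]_x F (f1 x) = \int[m2]_x F (f2 x))%E.
Proof.
move=> m12 mF F0.
have := ge0_integral_pushforward mf1 m1 measurableT mF (fun y _ => F0 y).
rewrite preimage_setT => <-.
have := ge0_integral_pushforward mf2 m2 measurableT mF (fun y _ => F0 y).
rewrite preimage_setT => <-.
by apply: eq_measure_integral => A mA _; exact: m12.
Qed.

Lemma eq_law_generator (G : set (set S)) :
  measurable = <<s G >> -> setI_closed G -> G setT ->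
  (m1 setT < +oo)%E -> (forall A, G A -> m1 (f1 @^-1` A) = m2 (f2 @^-1` A)) ->
  forall A, measurable A -> m1 (f1 @^-1` A) = m2 (f2 @^-1` A).
Proof.
move=> mG GI GT moo G12 A mA.
pose F1 : {mfun X1 >-> S} := HB.pack f1 (isMeasurableFun.Build _ _ _ _ _ mf1).
pose F2 : {mfun X2 >-> S} := HB.pack f2 (isMeasurableFun.Build _ _ _ _ _ mf2).
apply: (measure_unique G (fun=> setT) mG GI _ _ (pushforward m1 F1) (pushforward m2 F2)) => //.
by rewrite bigcup_const.
Qed.
End law_equality.

Section tuples.
Context {dY : measure_display} {T : measurableType dY} {n : nat}.
Implicit Types (y : n.-tuple T) (J : {set 'I_n}).

Definition rectangle (B : 'I_n -> set T) : set (n.-tuple T) :=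
  [set y | forall j, B j (tnth y j)].

Definition rectangles : set (set (n.-tuple T)) :=
  [set rectangle B | B in [set B | forall j, measurable (B j)]].

Lemma measurable_rectangle B : (forall j, measurable (B j)) ->
  measurable (rectangle B).
Proof.
move=> mB; rewrite (_ : rectangle B =
    \bigcap_(j in [set: 'I_n]) (@tnth n T ^~ j @^-1` B j)).
  apply: fin_bigcap_measurable => // j _; rewrite -[X in measurable X]setTI.
  exact: measurable_tnth.
by apply/seteqP; split => [y By j _|y By j]; exact: By.
Qed.

Lemma rectangles_generate : measurable = <<s rectangles >>.
Proof.
apply/seteqP; split.
  apply: smallest_sub; first exact: smallest_sigma_algebra.
  move=> A; rewrite -bigcup_seq => -[/= i _ [B mB <-]].
  apply: sub_sigma_algebra; exists (fun j => if j == i then B else setT).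
    by move=> j /=; case: ifP.
  rewrite setTI; apply/seteqP; split => [y /(_ i)|y By j] /=; first by rewrite eqxx.
  by case: eqP => // ->.
apply: smallest_sub; first exact: sigma_algebra_measurable.
by move=> _ [B mB <-]; exact: measurable_rectangle.
Qed.

Lemma rectangles_setI : setI_closed rectangles.
Proof.
move=> _ _ [B mB <-] [C mC <-]; exists (fun j => B j `&` C j).
  by move=> j; exact: measurableI.
apply/seteqP; split => [y BC|y [By Cy] j]; last by split.
by split => j; case: (BC j).
Qed.

Lemma rectangles_setT : rectangles setT.
Proof. by exists (fun=> setT) => //; apply/seteqP; split. Qed.

Definition mix J y y' : n.-tuple T :=
  [tuple if j \in J then tnth y' j else tnth y j | j < n].

Lemma measurable_mix J d' (S : measurableType d') (g g' : S -> n.-tuple T) :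
  measurable_fun [set: S] g -> measurable_fun [set: S] g' ->
  measurable_fun [set: S] (fun s => mix J (g s) (g' s)).
Proof.
move=> /measurable_fun_tnthP mg /measurable_fun_tnthP mg'.
apply/measurable_fun_tnthP => j.
rewrite (_ : _ \o _ = if j \in J then @tnth n T ^~ j \o g' else @tnth n T ^~ j \o g).
  by case: ifP.
by apply/funext => s /=; rewrite tnth_mktuple; case: ifP.
Qed.

Lemma set_coordE y i (y' : n.-tuple T) :
  set_coord y i (tnth y' i) = mix [set i] y y'.
Proof.
by apply: eq_from_tnth => j; rewrite !tnth_mktuple inE; case: eqP => // ->.
Qed.

Lemma measurable_set_coord i d' (S : measurableType d') (g : S -> n.-tuple T)
    (h : S -> T) : measurable_fun [set: S] g -> measurable_fun [set: S] h ->
  measurable_fun [set: S] (fun s => set_coord (g s) i (h s)).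
Proof.
move=> /measurable_fun_tnthP mg mh; apply/measurable_fun_tnthP => j.
rewrite (_ : _ \o _ = if j == i then h else @tnth n T ^~ j \o g).
  by case: ifP.
by apply/funext => s /=; rewrite tnth_mktuple; case: ifP.
Qed.

Lemma set_coord_idem y i u v : set_coord (set_coord y i u) i v = set_coord y i v.
Proof.
by apply: eq_from_tnth => j; rewrite !tnth_mktuple; case: eqP.
Qed.

Lemma set_coordC y i j u v : i != j ->
  set_coord (set_coord y i u) j v = set_coord (set_coord y j v) i u.
Proof.
move=> ij; apply: eq_from_tnth => k; rewrite !tnth_mktuple.
by case: (eqVneq k j) => // ->; case: eqVneq ij => // ->; rewrite eqxx.
Qed.

End tuples.

Section independent_coordinates.
Context {R : realType} {d dY : measure_display} {Omega : measurableType d}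
  {T : measurableType dY} {P : probability Omega R} {n : nat}.
Variable Y : 'I_n -> {RV P >-> T}.
Implicit Types (u : n.-tuple T -> R) (y : n.-tuple T) (k : 'I_n).

Lemma measurable_random_vector : measurable_fun [set: Omega] (random_vector Y).
Proof.
apply/measurable_fun_tnthP => j; rewrite (_ : _ \o _ = Y j)//.
by apply/funext => w /=; rewrite tnth_mktuple.
Qed.

Hypothesis indepY : mutually_independent Y.

Let W J (z : Omega * Omega) := mix J (random_vector Y z.1) (random_vector Y z.2).

Lemma measurable_mix_vector J : measurable_fun [set: Omega * Omega] (W J).
Proof.
by apply: measurable_mix; apply: measurableT_comp; rewrite //; exact: measurable_random_vector.
Qed.

(** On a rectangle the event is a product of an event on the coordinates outside [J] and one on
    those in [J], so independence gives the same product of probabilities on both sides. Every use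
    of independence goes through this lemma. *)
Lemma mix_law J A : measurable A ->
  (P \x P)%E (W J @^-1` A) = P (random_vector Y @^-1` A).
Proof.
apply: eq_law_generator A; [exact: measurable_mix_vector|
  exact: measurable_random_vector|exact: rectangles_generate|
  exact: rectangles_setI|exact: rectangles_setT| |].
  by rewrite -setXTT [ltLHS]product_measure1E//= probability_setT mule1 ltry.
move=> _ [B mB <-].
have PE (K : {set 'I_n}) : P [set w | forall j, j \in K -> B j (Y j w)] =
    (\prod_(j in K) P (Y j @^-1` B j))%E.
  rewrite -(indepY (J := K)) => [|j _]; last exact: mB.
  by congr (P _); apply/seteqP; split => [w Bw j /= jK|w Bw j jK]; exact: Bw.
have mE (K : {set 'I_n}) : measurable [set w | forall j, j \in K -> B j (Y j w)].
  rewrite (_ : [set w | _] = \bigcap_(j in [set` K]) (Y j @^-1` B j)).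
    apply: fin_bigcap_measurable => // j _; rewrite -[X in measurable X]setTI.
    exact: measurable_funPT.
  by apply/seteqP; split => [w Bw j /= jK|w Bw j jK]; exact: Bw.
have -> : W J @^-1` rectangle B =
    [set w | forall j, j \in ~: J -> B j (Y j w)] `*`
    [set w | forall j, j \in J -> B j (Y j w)].
  apply/seteqP; split => [[w w'] /= Bw|[w w'] /= [Bw Bw'] j]; last first.
    rewrite /= !tnth_mktuple; case: ifPn => jJ; first exact: Bw'.
    by apply: Bw; rewrite inE.
  by split=> j; rewrite ?inE => jJ; have := Bw j; rewrite /= !tnth_mktuple ?jJ// (negbTE jJ).
transitivity (P [set w | forall j, j \in ~: J -> B j (Y j w)] *
  P [set w | forall j, j \in J -> B j (Y j w)])%E; first exact: product_measure1E.
rewrite !PE.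
have -> : random_vector Y @^-1` rectangle B =
    [set w | forall j, j \in [set: 'I_n]%SET -> B j (Y j w)].
  apply/seteqP; split => [w Bw j _|w Bw j /=]; last by rewrite tnth_mktuple; apply: Bw; rewrite inE.
  by have := Bw j; rewrite /= tnth_mktuple.
rewrite [RHS]PE [RHS](bigID (mem J))/= muleC; congr (_ * _)%E; apply: eq_bigl => j.
  by rewrite !inE.
by rewrite !inE.
Qed.

End independent_coordinates.

Section coordinate_mean.
Context {R : realType} {d dY : measure_display} {Omega : measurableType d}
  {T : measurableType dY} {P : probability Omega R} {n : nat}.
Variable Y : 'I_n -> {RV P >-> T}.
Implicit Types (u v h : n.-tuple T -> R) (y : n.-tuple T) (k j : 'I_n).

Local Notation Yv := (random_vector Y).

Definition coord_mean k u y : R := \int[P]_w u (set_coord y k (Y k w)).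

Lemma coord_diffE k u y : coord_diff Y u k y = u y - coord_mean k u y.
Proof. by rewrite /coord_diff unlock. Qed.

Lemma measurable_resample y k :
  measurable_fun [set: Omega] (fun w => set_coord y k (Y k w)).
Proof. by apply: measurable_set_coord => //; exact: measurable_funPT. Qed.

Lemma measurable_resample2 k : measurable_fun [set: n.-tuple T * Omega]
  (fun z => set_coord z.1 k (Y k z.2)).
Proof.
apply: measurable_set_coord => //.
by apply: measurableT_comp => //; exact: measurable_funPT.
Qed.

Lemma measurable_coord_integral k (F : n.-tuple T -> \bar R) :
  measurable_fun [set: n.-tuple T] F -> (forall y, 0 <= F y)%E ->
  measurable_fun [set: n.-tuple T] (fun y => \int[P]_w F (set_coord y k (Y k w)))%E.
Proof.
move=> mF F0.
apply: (@measurable_fun_fubini_tonelli_F _ _ _ _ _ P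
  (fun z : n.-tuple T * Omega => F (set_coord z.1 k (Y k z.2)))) => //.
exact: measurableT_comp mF (measurable_resample2 k).
Qed.

Lemma measurable_coord_mean k u : measurable_fun [set: n.-tuple T] u ->
  measurable_fun [set: n.-tuple T] (coord_mean k u).
Proof.
move=> mu; have mE : measurable_fun [set: n.-tuple T] (EFin \o u) by exact/measurable_EFinP.
have mp := measurable_coord_integral k (measurable_funepos mE) (funepos_ge0 (EFin \o u)).
have mn := measurable_coord_integral k (measurable_funeneg mE) (funeneg_ge0 (EFin \o u)).
have mI : measurable_fun [set: n.-tuple T]
    (fun y => \int[P]_w (u (set_coord y k (Y k w)))%:E)%E.
  rewrite (_ : (fun y => _) = fun y =>
    (\int[P]_w (EFin \o u)^\+ (set_coord y k (Y k w)) -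
     \int[P]_w (EFin \o u)^\- (set_coord y k (Y k w)))%E).
    exact: emeasurable_funB.
  apply/funext => y; rewrite integralE.
  by congr (_ - _)%E; apply: eq_integral => w _; rewrite ?funeposE ?funenegE.
exact: measurableT_comp (fine_measurable measurableT) mI.
Qed.

Lemma coord_mean_set_coord k u y t : coord_mean k u (set_coord y k t) = coord_mean k u y.
Proof. by apply: eq_Rintegral => w _; rewrite set_coord_idem. Qed.

Lemma bmeas_vector u : bmeas u -> bmeas (u \o Yv).
Proof.
move=> [mu [M uM]]; split; last by exists M => w; exact: uM.
exact: measurableT_comp mu (measurable_random_vector Y).
Qed.

Lemma bmeas_resample y k u : bmeas u -> bmeas (fun w => u (set_coord y k (Y k w))).
Proof.
move=> [mu [M uM]]; split; last by exists M => w; exact: uM.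
exact: measurableT_comp mu (measurable_resample y k).
Qed.

Lemma coord_mean_ge k u y (c : R) : bmeas u -> (forall y, c <= u y) -> c <= coord_mean k u y.
Proof. by move=> bu cu; apply: mean_ge => //; exact: bmeas_resample. Qed.

Lemma bmeas_coord_mean k u : bmeas u -> bmeas (coord_mean k u).
Proof.
move=> bu; split; first by apply: measurable_coord_mean; case: bu.
have [_ [M uM]] := bu; exists M => y; rewrite ler_norml; apply/andP; split.
  by apply: coord_mean_ge => // z; have := uM z; rewrite ler_norml => /andP[].
rewrite -[leRHS](mean_cst P); apply: mean_le; first exact: bmeas_resample.
  exact: bmeas_cst.
by move=> w; exact: le_trans (ler_norm _) (uM _).
Qed.

Lemma coord_meanM k u v y : bmeas u -> (forall y t, v (set_coord y k t) = v y) ->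
  coord_mean k (fun y => v y * u y) y = v y * coord_mean k u y.
Proof.
move=> bu vk; rewrite /coord_mean.
under eq_Rintegral do rewrite vk.
by rewrite meanZ//; exact: bmeas_resample.
Qed.

Lemma coord_mean_invariant k j u : (forall y t, u (set_coord y j t) = u y) ->
  forall y t, coord_mean k u (set_coord y j t) = coord_mean k u y.
Proof.
move=> uj y t; have [<-|kj] := eqVneq k j; first exact: coord_mean_set_coord.
by apply: eq_Rintegral => w _; rewrite -set_coordC// uj.
Qed.

Hypothesis indepY : mutually_independent Y.

Lemma resample_integral k (F : n.-tuple T -> \bar R) :
  measurable_fun [set: n.-tuple T] F -> (forall y, 0 <= F y)%E ->
  (\int[P]_w \int[P]_w' F (set_coord (Yv w) k (Y k w')) = \int[P]_w F (Yv w))%E.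
Proof.
move=> mF F0.
have E w w' : set_coord (Yv w) k (Y k w') = mix [set k]%SET (Yv w) (Yv w').
  by rewrite -set_coordE tnth_mktuple.
under eq_integral do under eq_integral do rewrite E.
rewrite -(eq_law_integral (measurable_mix_vector Y [set k]%SET)
  (measurable_random_vector Y) (mix_law indepY [set k]%SET) mF F0).
rewrite (@fubini_tonelli1 _ _ _ _ _ P P (fun z => F (mix [set k]%SET (Yv z.1) (Yv z.2))))//.
exact: measurableT_comp mF (measurable_mix_vector Y [set k]%SET).
Qed.

Lemma mean_coord_mean k u : bmeas u ->
  \int[P]_w coord_mean k u (Yv w) = \int[P]_w u (Yv w).
Proof.
move=> bu; have [mu [M uM]] := bu.
(* [resample_integral] is stated for nonnegative functions; adding the bound [M] reduces to that
   case. *)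
have bM : bmeas (fun y => u y + M) by apply: bmeasD => //; exact: bmeas_cst.
have M0 y : 0 <= u y + M by have := uM y; rewrite ler_norml => /andP[]; lra.
have mM : measurable_fun setT (fun y => (u y + M)%:E).
  by apply/measurable_EFinP; case: bM.
have := resample_integral k mM M0.
rewrite [RHS]EFin_mean; last exact: bmeas_integrable (bmeas_vector bM).
under eq_integral do
  rewrite EFin_mean ?(bmeas_integrable _ (bmeas_resample _ _ bM))// -/(coord_mean k _ _).
rewrite EFin_mean; last exact: bmeas_integrable (bmeas_vector (bmeas_coord_mean k bM)).
move=> [].
have cM y : coord_mean k (fun y => u y + M) y = coord_mean k u y + M.
  rewrite /coord_mean meanD ?mean_cst//; first exact: bmeas_resample.
  exact: bmeas_cst.
have cMI : {in [set: Omega], (fun w => coord_mean k (fun y => u y + M) (Yv w)) =1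
    (fun w => coord_mean k u (Yv w) + M)} by move=> w _; exact: cM.
rewrite (eq_Rintegral P cMI).
rewrite !meanD ?mean_cst; [exact: addIr|..|exact: bmeas_cst]; first exact: bmeas_vector.
- exact: bmeas_cst.
- exact: (bmeas_vector (bmeas_coord_mean k bu)).
Qed.

End coordinate_mean.

(** * Tensorization of entropy *)

Section entropy.
Context {R : realType} {d dY : measure_display} {Omega : measurableType d}
  {T : measurableType dY} {P : probability Omega R} {n : nat}.
Variable Y : 'I_n -> {RV P >-> T}.
Hypothesis indepY : mutually_independent Y.
Implicit Types (u v h : n.-tuple T -> R) (y : n.-tuple T) (k j : 'I_n).

Local Notation Yv := (random_vector Y).

Definition coord_means s h := foldl (fun u k => coord_mean Y k u) h s.

Lemma bmeas_coord_means s h : bmeas h -> bmeas (coord_means s h).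
Proof. by elim: s h => //= k s IH h bh; apply: IH; exact: bmeas_coord_mean. Qed.

Lemma mean_coord_means s h : bmeas h ->
  \int[P]_w coord_means s h (Yv w) = \int[P]_w h (Yv w).
Proof.
elim: s h => //= k s IH h bh; rewrite IH ?mean_coord_mean//.
exact: bmeas_coord_mean.
Qed.

Lemma coord_means_invariant s h k : k \in s \/ (forall y t, h (set_coord y k t) = h y) ->
  forall y t, coord_means s h (set_coord y k t) = coord_means s h y.
Proof.
elim: s h => [|j s IH] h /=; first by case.
rewrite inE => hk; apply: IH; case: (boolP (k \in s)) => ks; [by left|right].
move: hk; rewrite (negbTE ks) orbF => -[/eqP ->|hk]; first exact: coord_mean_set_coord.
exact: coord_mean_invariant.
Qed.

Lemma invariant_constant u : (forall k y t, u (set_coord y k t) = u y) ->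
  forall y y', u y = u y'.
Proof.
move=> uk y y'; pose m s := foldl (fun z k => set_coord z k (tnth y' k)) y s.
have um s : u (m s) = u y.
  rewrite {}/m; elim: s y => //= k s IH z; rewrite IH; exact: uk.
rewrite -(um (enum 'I_n)); congr u; apply: eq_from_tnth => j.
suff mE s z : tnth (foldl (fun z k => set_coord z k (tnth y' k)) z s) j =
    if j \in s then tnth y' j else tnth z j by rewrite mE mem_enum.
elim: s z => //= k s IH z; rewrite IH inE; case: ifP; rewrite ?orbT ?orbF//.
by rewrite tnth_mktuple; case: eqP => // ->.
Qed.

(** Averaging over every coordinate leaves a function that no change of coordinate affects, hence a
    constant, and a constant equals its mean. *)
Lemma mean_coord_means_enum h y : bmeas h ->
  coord_means (enum 'I_n) h y = \int[P]_w h (Yv w).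
Proof.
move=> bh; rewrite -(mean_coord_means (enum 'I_n))//.
rewrite -[LHS](mean_cst P); apply: eq_Rintegral => w _; apply: invariant_constant.
by move=> k z t; apply: coord_means_invariant; left; rewrite mem_enum.
Qed.

Lemma coord_means_ge s h (e : R) y : bmeas h -> (forall y, e <= h y) -> e <= coord_means s h y.
Proof.
elim: s h => //= k s IH h bh eh; apply: IH; first exact: bmeas_coord_mean.
by move=> z; exact: coord_mean_ge.
Qed.

Lemma bmeas_Phi d' (S : measurableType d') (u : S -> R) : bmeas u -> bmeas (fun x => Phi (u x)).
Proof.
move=> [mu [M uM]]; split; first exact: measurableT_comp measurable_Phi mu.
exists (M ^+ 2 / 2 * expR M) => x; rewrite ger0_norm ?Phi_ge0//.
have M0 : 0 <= M := le_trans (normr_ge0 _) (uM x).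
have ux : u x <= M := le_trans (ler_norm _) (uM x).
rewrite /Phi ler_pM ?expR_ge0 ?divr_ge0 ?sqr_ge0//.
  by rewrite ler_pM2r ?invr_gt0// -(real_normK (num_real (u x))) ler_pXn2r ?nnegrE.
by rewrite ler_expR ge_max ux.
Qed.

Lemma mean_centred_affine (q : R) (a : Omega -> R) : bmeas a ->
  \int[P]_w a w = 0 -> \int[P]_w (q + q * a w) = q.
Proof.
move=> ba a0; rewrite meanD; [|exact: bmeas_cst|exact: bmeasZ].
by rewrite mean_cst meanZ// a0 mulr0 addr0.
Qed.

Variables (f : n.-tuple T -> R) (lam : R).
Hypothesis bf : bmeas f.

Let g y := expR (lam * f y).

Let bg : bmeas g. Proof. by apply: bmeas_expR; exact: bmeasZ. Qed.

Definition local_Phi k y : R :=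
  coord_mean Y k (fun y' => Phi (lam * (f y' - coord_mean Y k f y'))) y.

Lemma bmeas_centred k : bmeas (fun y => lam * (f y - coord_mean Y k f y)).
Proof. by apply: bmeasZ; apply: bmeasB => //; exact: bmeas_coord_mean. Qed.

Lemma bmeas_local_Phi k : bmeas (local_Phi k).
Proof. by apply: bmeas_coord_mean; apply: bmeas_Phi; exact: bmeas_centred. Qed.

(** The factor [e^(lam c)] with [c = E_k f] is taken out of [g], leaving a centred exponent [a].
    Young's inequality with [q = h], [H = E_k h] leaves the error [h / H - 1], whose mean is [0].
    Jensen's inequality, in the form [e^a >= 1 + a] with [E a = 0], then replaces [e^(lam c)] by
    [E_k g]. *)
Lemma coord_mean_entropy k h (e : R) y : bmeas h -> 0 < e -> (forall y, e <= h y) ->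
  coord_mean Y k (fun y => g y * (ln (h y) - ln (coord_mean Y k h y))) y <=
  coord_mean Y k g y * local_Phi k y.
Proof.
move=> bh e0 eh; pose c := coord_mean Y k f y; pose H := coord_mean Y k h y.
have H0 : 0 < H by apply: lt_le_trans e0 _; exact: coord_mean_ge.
pose rs u w := u (set_coord y k (Y k w)).
have brs u : bmeas u -> bmeas (rs u) by exact: bmeas_resample.
pose a w := lam * (rs f w - c).
have ba : bmeas a by apply: bmeasZ; apply: bmeasB; [exact: brs|exact: bmeas_cst].
have gE w : rs g w = expR (lam * c) * expR (a w).
  by rewrite -expRD /a /rs /g; congr expR; lra.
have meana : \int[P]_w a w = 0.
  rewrite /a meanZ; last by apply: bmeasB; [exact: brs|exact: bmeas_cst].
  by rewrite meanB ?mean_cst ?subrr ?mulr0//; [exact: brs|exact: bmeas_cst].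
have vE : local_Phi k y = \int[P]_w Phi (a w).
  by apply: eq_Rintegral => w _; rewrite coord_mean_set_coord.
have v0 : 0 <= local_Phi k y.
  by rewrite vE; apply: mean_ge => [|w]; [exact: bmeas_Phi|exact: Phi_ge0].
have bb : bmeas (fun w => ln (rs h w)) by apply: (bmeas_ln e0) => [|w]; [exact: brs|exact: eh].
have Gle : expR (lam * c) <= coord_mean Y k g y.
  rewrite -(mean_centred_affine (expR (lam * c)) ba meana).
  apply: mean_le; [|exact: brs|].
    by apply: bmeasD; [exact: bmeas_cst|exact: bmeasZ].
  move=> w; rewrite -/(rs g w) gE; have := expR_ge1Dx (a w).
  by move=> /(ler_wpM2l (expR_ge0 (lam * c))); lra.
apply: (@le_trans _ _ (expR (lam * c) * local_Phi k y)); last by rewrite ler_wpM2r.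
have bD : bmeas (fun w => ln (rs h w) - ln H) by exact: bmeasB bb (bmeas_cst (ln H)).
have -> : coord_mean Y k (fun y => g y * (ln (h y) - ln (coord_mean Y k h y))) y =
    expR (lam * c) * \int[P]_w (expR (a w) * (ln (rs h w) - ln H)).
  rewrite -meanZ; last exact: bmeasM (bmeas_expR ba) bD.
  by apply: eq_Rintegral => w _; rewrite -/(rs g w) gE coord_mean_set_coord mulrA.
apply: ler_wpM2l; [exact: expR_ge0|rewrite vE].
have bHh : bmeas (fun w => H^-1 * rs h w) by exact: bmeasZ (brs h bh).
have mHh : \int[P]_w (H^-1 * rs h w) = 1.
  by rewrite (meanZ P _ (brs h bh)); exact: mulVf (lt0r_neq0 H0).
have bHh1 := bmeasB bHh (bmeas_cst 1).
have E3 : \int[P]_w (H^-1 * rs h w - 1) = 0.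
  by rewrite (meanB P bHh (bmeas_cst 1)) mHh mean_cst subrr.
have E4 := meanD P (bmeas_Phi ba) bHh1.
have E5 := etrans E4 (etrans (congr1 (fun q => _ + q) E3) (addr0 _)).
rewrite -[leRHS]E5.
apply: mean_le; [exact: bmeasM (bmeas_expR ba) bD|exact: bmeasD (bmeas_Phi ba) bHh1|].
move=> w; have h0 : 0 < rs h w := lt_le_trans e0 (eh _).
exact: (Phi_young (a w) h0 H0).
Qed.

(** [local_Phi k] does not depend on coordinate [k], so [E_k g] times it is [E_k] of the product,
    and the outer mean absorbs [E_k] on both sides. *)
Lemma mean_entropy_step k h (e : R) : bmeas h -> 0 < e -> (forall y, e <= h y) ->
  \int[P]_w (g (Yv w) * (ln (h (Yv w)) - ln (coord_mean Y k h (Yv w)))) <=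
  \int[P]_w (g (Yv w) * local_Phi k (Yv w)).
Proof.
move=> bh e0 eh.
have bl u : bmeas u -> (forall y, e <= u y) -> bmeas (fun y => ln (u y)) by move=> ? ?; exact: (bmeas_ln e0).
have bch := bmeas_coord_mean Y k bh.
have bL : bmeas (fun y => g y * (ln (h y) - ln (coord_mean Y k h y))).
  apply: bmeasM => //; apply: bmeasB; apply: bl => // y; exact: coord_mean_ge.
have bR : bmeas (fun y => local_Phi k y * g y).
  by apply: bmeasM => //; exact: bmeas_local_Phi.
rewrite -[leLHS](mean_coord_mean indepY k bL).
under [leRHS]eq_Rintegral do rewrite mulrC.
rewrite -[leRHS](mean_coord_mean indepY k bR); apply: mean_le.
- exact: (bmeas_vector Y (bmeas_coord_mean Y k bL)).
- exact: (bmeas_vector Y (bmeas_coord_mean Y k bR)).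
move=> w; have vk := coord_mean_set_coord Y k (fun y => Phi (lam * (f y - coord_mean Y k f y))).
have E := esym (coord_meanM Y (Yv w) bg vk).
apply: le_trans (coord_mean_entropy k (Yv w) bh e0 eh) _; by rewrite mulrC [leLHS]E.
Qed.

(** The differences of logarithms telescope. The weight [g] stays fixed while [h] is left free,
    because each step hands its average on to the next. *)
Lemma mean_entropy_steps s h (e : R) : bmeas h -> 0 < e -> (forall y, e <= h y) ->
  \int[P]_w (g (Yv w) * (ln (h (Yv w)) - ln (coord_means s h (Yv w)))) <=
  \sum_(k <- s) \int[P]_w (g (Yv w) * local_Phi k (Yv w)).
Proof.
elim: s h => [|k s IH] h bh e0 eh /=.
  rewrite big_nil; under eq_Rintegral do rewrite subrr mulr0.
  by rewrite mean_cst.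
rewrite big_cons; have bch := bmeas_coord_mean Y k bh.
have ech y : e <= coord_mean Y k h y by exact: coord_mean_ge.
have bl u : bmeas u -> (forall y, e <= u y) -> bmeas (fun y => ln (u y)) by move=> ? ?; exact: (bmeas_ln e0).
have := lerD (mean_entropy_step k bh e0 eh) (IH _ bch e0 ech).
apply: le_trans; rewrite -meanD; last 2 first.
- apply: (@bmeas_vector _ _ _ _ _ _ _ Y) (fun y => g y * (ln (h y) - ln (coord_mean Y k h y))) _.
  by apply: bmeasM => //; apply: bmeasB; exact: bl.
- apply: (@bmeas_vector _ _ _ _ _ _ _ Y) (fun y => g y * (ln (coord_mean Y k h y) - ln (coord_means s (coord_mean Y k h) y))) _.
  apply: bmeasM => //; apply: bmeasB; first exact: bl.
  by apply: bl; [exact: bmeas_coord_means|move=> y; exact: coord_means_ge].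
by rewrite le_eqVlt; apply/orP; left; apply/eqP; apply: eq_Rintegral => w _; lra.
Qed.

(** With [h = g] the last average in the telescoped bound is the constant [F], and [ln g = lam f],
    so its left-hand side is the entropy of [g]. *)
Lemma entropy_inequality (S F : R) : 0 <= S -> F = \int[P]_w g (Yv w) ->
  {ae P, forall w, \sum_(k < n) local_Phi k (Yv w) <= S} ->
  \int[P]_w (g (Yv w) * (lam * f (Yv w))) - F * ln F <= S * F.
Proof.
move=> S0 FE aeS.
have [e e0 eg] : exists2 e, 0 < e & forall y, e <= g y.
  have [_ [M lM]] := bmeasZ lam bf; exists (expR (- M)); first exact: expR_gt0.
  by move=> y; rewrite ler_expR; have := lM y; rewrite ler_norml => /andP[].
have bgv := bmeas_vector Y bg.
have := mean_entropy_steps (enum 'I_n) bg e0 eg.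
have -> : \int[P]_w (g (Yv w) * (ln (g (Yv w)) - ln (coord_means (enum 'I_n) g (Yv w)))) =
    \int[P]_w (g (Yv w) * (lam * f (Yv w))) - F * ln F.
  have b1 : bmeas (fun w => g (Yv w) * (lam * f (Yv w))).
    exact: bmeasM bgv (bmeasZ lam (bmeas_vector Y bf)).
  have b2 := bmeasZ (ln F) bgv.
  have -> : F * ln F = \int[P]_w (ln F * g (Yv w)).
    by rewrite (meanZ P (ln F) bgv) mulrC FE.
  rewrite -(meanB P b1 b2).
  by apply: eq_Rintegral => w _; rewrite mean_coord_means_enum// -FE /= mulrBr [ln F * _]mulrC /g expRK.
move=> /le_trans; apply.
rewrite big_enum/= -mean_sum; last first.
  by move=> k; apply: bmeasM => //; exact: (bmeas_vector Y (bmeas_local_Phi k)).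
rewrite FE -(meanZ P S bgv).
have g0 w : 0 <= g (Yv w) := expR_ge0 _.
have v0 k y : 0 <= local_Phi k y.
  apply: coord_mean_ge => [|z]; last exact: Phi_ge0.
  by apply: bmeas_Phi; exact: bmeas_centred.
have bsum : bmeas (fun w => \sum_(k < n) g (Yv w) * local_Phi k (Yv w)).
  by apply: bmeas_sum => k; apply: bmeasM => //; exact: (bmeas_vector Y (bmeas_local_Phi k)).
rewrite -lee_fin -!EFin_mean; [|exact: bmeas_integrable (bmeasZ _ _)|exact: bmeas_integrable].
apply: ae_ge0_le_integral => //.
- by move=> w _; rewrite lee_fin sumr_ge0// => k _; rewrite mulr_ge0.
- by apply/measurable_EFinP; case: bsum.
- by move=> w _; rewrite lee_fin; exact: mulr_ge0 S0 (g0 w).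
- by apply/measurable_EFinP; case: (bmeasZ S bgv).
move: aeS; apply: filterS => w hw _; rewrite lee_fin -mulr_sumr mulrC.
exact: ler_wpM2r (g0 w) _ _ hw.
Qed.

End entropy.

(** * Integrating the entropy inequality *)

Section log_mgf.
Context {d} {T : measurableType d} {R : realType} (P : probability T R).
Variable X : T -> R.
Hypothesis bX : bmeas X.

Let F (s : R) := \int[P]_w expR (s * X w).
Let L (s : R) := ln (F s).

Let bexp s : bmeas (fun w => expR (s * X w)).
Proof. by apply: bmeas_expR; exact: bmeasZ. Qed.

Lemma mgf_gt0 s : 0 < F s.
Proof.
have [_ [M lM]] := bmeasZ s bX; apply: (@lt_le_trans _ _ (expR (- M))); first exact: expR_gt0.
by apply: mean_ge => // w; rewrite ler_expR; have := lM w; rewrite ler_norml => /andP[].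
Qed.

Lemma expR_le_quadratic (t M : R) : `|t| <= M -> expR t <= 1 + t + t ^+ 2 * expR M.
Proof.
rewrite ler_norml => /andP[tM1 tM2].
have et : expR t - 1 <= t * expR t.
  have := expR_ge1Dx (- t); rewrite expRN.
  by move=> /(ler_wpM2l (expR_ge0 t)); rewrite divff ?gt_eqF ?expR_gt0//; lra.
have et1 := expR_ge1Dx t.
have [t0|t0] := leP 0 t.
  have : expR t <= expR M by rewrite ler_expR.
  have := sqr_ge0 t; nra.
have : 1 <= expR M by rewrite -expR0 ler_expR; lra.
have := sqr_ge0 t; nra.
Qed.

(** The boundary value for Herbst's argument: [L s / s] exceeds the mean by at most [C s] near [0].
    It comes from [ln F <= F - 1] and a second-order bound on the exponential. *)
Lemma log_mgf_small (lam : R) : exists2 C : R, 0 <= C & forall s : R, 0 < s -> s <= lam ->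
  L s <= s * (\int[P]_w X w) + s ^+ 2 * C.
Proof.
have [_ [M XM]] := bX; exists (M ^+ 2 * expR (lam * M)).
  by rewrite mulr_ge0 ?sqr_ge0 ?expR_ge0.
move=> s s0 sl; apply: le_trans (_ : F s - 1 <= _).
  by have := expR_ge1Dx (L s); rewrite lnK ?posrE ?mgf_gt0//; lra.
have bq : bmeas (fun w => 1 + s * X w + s ^+ 2 * (M ^+ 2 * expR (lam * M))).
  by apply: bmeasD; [apply: bmeasD; [exact: bmeas_cst|exact: bmeasZ]|exact: bmeas_cst].
have -> : s * (\int[P]_w X w) + s ^+ 2 * (M ^+ 2 * expR (lam * M)) =
   \int[P]_w (1 + s * X w + s ^+ 2 * (M ^+ 2 * expR (lam * M))) - 1.
  rewrite meanD ?mean_cst; [|by apply: bmeasD; [exact: bmeas_cst|exact: bmeasZ]|exact: bmeas_cst].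
  by rewrite meanD ?mean_cst ?meanZ//; [lra|exact: bmeas_cst|exact: bmeasZ].
rewrite lerD2r; apply: mean_le => // w.
have M0 : 0 <= M := le_trans (normr_ge0 _) (XM w).
have sXM : `|s * X w| <= lam * M by rewrite normrM (gtr0_norm s0) ler_pM// ltW.
apply: le_trans (expR_le_quadratic sXM) _; rewrite lerD2l mulrA.
rewrite ler_wpM2r ?expR_ge0// exprMn ler_wpM2l ?sqr_ge0//.
by rewrite -(real_normK (num_real (X w))) ler_pXn2r ?nnegrE.
Qed.

(** Convexity of [L] without differentiating under the integral: [c] is the mean of [X] under the
    measure tilted by [e^(s X)], and [e^y >= 1 + y] is averaged there at [y = (s' - s) (X - c)]. *)
Lemma log_mgf_tangent (s s' c : R) : c * F s = \int[P]_w (X w * expR (s * X w)) ->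
  L s + (s' - s) * c <= L s'.
Proof.
move=> cE; have F0 := mgf_gt0 s; have F0' := mgf_gt0 s'.
have bXe : bmeas (fun w => X w * expR (s * X w)) by exact: bmeasM.
suff : expR ((s' - s) * c) * F s <= F s'.
  rewrite -[X in _ <= X]lnK ?posrE// -[X in _ * X]lnK ?posrE// -expRD ler_expR.
  by rewrite addrC.
pose q := expR ((s' - s) * c).
have b2 : bmeas (fun w => (X w * expR (s * X w)) - c * expR (s * X w)).
  by apply: bmeasB => //; exact: bmeasZ.
have <- : \int[P]_w (q * (expR (s * X w) + (s' - s) * ((X w * expR (s * X w)) - c * expR (s * X w)))) = q * F s.
  rewrite meanZ; last by apply: bmeasD => //; exact: bmeasZ.
  congr (_ * _); rewrite meanD//; last exact: bmeasZ.
  rewrite meanZ// meanB//; last exact: bmeasZ.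
  by rewrite -cE meanZ// -/(F s); lra.
apply: mean_le => // [|w].
  by apply: bmeasZ; apply: bmeasD => //; exact: bmeasZ.
have -> : expR (s' * X w) = q * (expR (s * X w) * expR ((s' - s) * (X w - c))).
  by rewrite /q -!expRD; congr expR; lra.
apply: ler_wpM2l; first exact: expR_ge0.
have := expR_ge1Dx ((s' - s) * (X w - c)).
by move=> /(ler_wpM2l (expR_ge0 (s * X w))); lra.
Qed.

End log_mgf.
Section herbst.
Context {d} {T : measurableType d} {R : realType} (P : probability T R).
Variable X : T -> R.
Hypothesis bX : bmeas X.

Let F (s : R) := \int[P]_w expR (s * X w).
Let L (s : R) := ln (F s).

Let bexp s : bmeas (fun w => expR (s * X w)).
Proof. by apply: bmeas_expR; exact: bmeasZ. Qed.
Variables (v B lam : R).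
Hypotheses (v0 : 0 <= v) (B0 : 0 <= B) (lam0 : 0 < lam) (Blam : B * lam < 1).
Hypothesis ent : forall s : R, 0 < s -> s <= lam ->
  \int[P]_w (expR (s * X w) * (s * X w)) - F s * ln (F s) <=
  v * s ^+ 2 / (2 * (1 - B * s) ^+ 2) * F s.

(* In the coordinate [rho = 1 / s - B] the entropy bound reads
   [- N' (rho) <= v / (2 rho ^ 2)] for [N = L s / s]; it is integrated along
   geometric sequences [q ^ m rho], on which the error is exactly a factor [q]. *)
Let N (rho : R) := L (rho + B)^-1 * (rho + B).
Let rho0 := lam^-1 - B.

Let rho0_gt0 : 0 < rho0.
Proof. by rewrite subr_gt0 -[lam^-1]mul1r ltr_pdivlMr. Qed.

Lemma herbst_step (rho rho' : R) : rho0 <= rho -> rho <= rho' ->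
  N rho <= N rho' + (rho' - rho) * (v / 2 / rho ^+ 2).
Proof.
move=> r0 rr'; have rho_gt0 : 0 < rho := lt_le_trans rho0_gt0 r0.
pose s : R := (rho + B)^-1; pose s' : R := (rho' + B)^-1.
have s0 : 0 < s by rewrite invr_gt0 ltr_wpDr.
have sl : s <= lam.
  by rewrite -[lam]invrK lef_pV2 ?posrE ?invr_gt0 ?ltr_wpDr// -lerBlDr.
have F0 := mgf_gt0 P bX s.
pose c := \int[P]_w (X w * expR (s * X w)) / F s.
have cE : c * F s = \int[P]_w (X w * expR (s * X w)) by rewrite /c divfK ?gt_eqF.
have tg := log_mgf_tangent bX s' cE.
have bXe : bmeas (fun w => X w * expR (s * X w)) by exact: bmeasM.
have := ent s0 sl.
have -> : \int[P]_w (expR (s * X w) * (s * X w)) = s * (c * F s).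
  by rewrite cE -meanZ//; apply: eq_Rintegral => w _; rewrite mulrCA [X in _ * X]mulrC.
by move=> en; exact: herbst_algebra en tg.
Qed.

Lemma herbst_iter (q : R) m : 1 < q ->
  N rho0 <= N (q ^+ m * rho0) + q * (v / 2) * (rho0^-1 - (q ^+ m * rho0)^-1).
Proof.
move=> q1; elim: m => [|m IH]; first by rewrite expr0 mul1r subrr mulr0 addr0.
apply: le_trans IH _; set rho := q ^+ m * rho0.
have r0 : rho0 <= rho by rewrite /rho ler_peMl// ?exprn_ege1// ltW.
have rho_gt0 : 0 < rho := lt_le_trans rho0_gt0 r0.
have rq : rho <= q * rho by rewrite ler_peMl ?ltW.
have -> : q ^+ m.+1 * rho0 = q * rho by rewrite exprS -mulrA.
have := herbst_step r0 rq; clearbody rho.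
have -> : (q * rho - rho) * (v / 2 / rho ^+ 2) = q * (v / 2) * (rho^-1 - (q * rho)^-1).
  by field; rewrite !gt_eqF// (lt_trans ltr01).
move=> h; rewrite -lerBrDr; apply: le_trans h _.
by rewrite -addrA lerD2l; lra.
Qed.

Lemma log_mgf_le : L lam <= lam * (\int[P]_w X w) + v * lam ^+ 2 / (2 * (1 - B * lam)).
Proof.
have [C C0 smallC] := log_mgf_small P bX lam.
have r0 := rho0_gt0.
have lamE : (rho0 + B)^-1 = lam by rewrite /rho0 subrK invrK.
have B1 : 0 < 1 - B * lam by rewrite subr_gt0.
suff : N rho0 <= \int[P]_w X w + v / 2 / rho0.
  rewrite /N lamE -(ler_pM2l lam0) mulrCA /rho0 subrK divff ?gt_eqF// mulr1.
  move=> /le_trans; apply; rewrite mulrDr lerD2l.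
  have -> : lam^-1 - B = (1 - B * lam) / lam by field; rewrite gt_eqF.
  by rewrite le_eqVlt; apply/orP; left; apply/eqP; field; rewrite !gt_eqF.
apply: (herbst_limit C0 v0 r0) => m.
pose q : R := 1 + m.+1%:R^-1.
have q1 : 1 < q by rewrite /q ltrDl invr_gt0.
have it := herbst_iter (m.+1 * m.+1) q1.
have pm := bernoulli_power R m.
exists (q ^+ (m.+1 * m.+1)) => //; move: it pm; rewrite -/q.
set p := q ^+ _ => it pm.
have p0 : 0 < p by apply: lt_le_trans pm.
have pr0 : 0 < p * rho0 by rewrite mulr_gt0.
apply: le_trans it _; rewrite lerD2r.
pose s : R := (p * rho0 + B)^-1.
have sB : 0 < p * rho0 + B by rewrite ltr_wpDr.
have s0 : 0 < s by rewrite invr_gt0.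
have sl : s <= lam.
  have r0B : 0 < rho0 + B by exact: ltr_wpDr.
  rewrite -lamE lef_pV2 ?posrE//.
  rewrite lerD2r ler_peMl ?(ltW r0)//; apply: le_trans pm.
  by rewrite ler1n.
(* At the far end [s <= 1 / (p rho0)], so the bound near [0] gives [N (p rho0)] at most the mean
   plus [C / (p rho0)]. *)
have := smallC s s0 sl; rewrite -(ler_pM2r sB) /N -/s => /le_trans; apply.
have sE : s * (p * rho0 + B) = 1 by rewrite mulVf ?gt_eqF.
have -> : (s * \int[P]_w X w + s ^+ 2 * C) * (p * rho0 + B) =
    (s * (p * rho0 + B)) * (\int[P]_w X w + s * C) by ring.
rewrite sE mul1r lerD2l mulrC ler_wpM2l// lef_pV2 ?posrE//.
by rewrite lerDl.
Qed.

End herbst.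

(** * Conditional objects given all coordinates but one *)

Section almost_everywhere_rational.
Context {d} {T : measurableType d} {R : realType} (mu : {measure set T -> \bar R}).

Lemma ae_forall_count (I : countType) (Q : I -> T -> Prop) :
  (forall i, {ae mu, forall w, Q i w}) -> {ae mu, forall w, forall i, Q i w}.
Proof.
move=> h; pose Q' (m : nat) w := if unpickle m is Some i then Q i w else True.
have : {ae mu, forall w, forall m, Q' m w}.
  apply: ae_foralln => m; rewrite /Q'; case: (unpickle m) => [i|]; first exact: h.
  by apply: aeW.
by apply: filterS => w h' i; have := h' (pickle i); rewrite /Q' pickleK.
Qed.

End almost_everywhere_rational.

Section conditional.
Context {d} {Omega : measurableType d} {R : realType} (P : probability Omega R).
Variable G : set (set Omega).
Hypothesis Gm : G.-sigma.-measurable `<=` d.-measurable.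

Lemma measurable_fun_sub d' (S : measurableType d') (V : Omega -> S) :
  measurable_fun setT (V : g_sigma_algebraType G -> S) -> measurable_fun setT V.
Proof. by move=> mV _ B mB; apply: Gm; exact: mV. Qed.

(** The set where [Z < V] is covered by the sets [Z <= p], [q <= V] over rationals [0 <= p < q].
    Each lies in the sub-sigma-algebra, and [q P(A) <= p P(A)] forces it to be null. *)
Lemma ae_le_integral_sub (V Z : Omega -> \bar R) :
  measurable_fun setT (V : g_sigma_algebraType G -> \bar R) ->
  measurable_fun setT (Z : g_sigma_algebraType G -> \bar R) ->
  (forall w, 0 <= V w)%E -> (forall w, 0 <= Z w)%E ->
  (forall A, G.-sigma.-measurable A -> (\int[P]_(w in A) V w <= \int[P]_(w in A) Z w)%E) ->
  {ae P, forall w, (V w <= Z w)%E}.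
Proof.
move=> mV mZ V0 Z0 VZ.
have mV' := measurable_fun_sub mV; have mZ' := measurable_fun_sub mZ.
have key (pq : rat * rat) : {ae P, forall w,
    ratr pq.1 < ratr pq.2 :> R -> 0 <= ratr pq.1 :> R ->
    ~ ((Z w <= (ratr pq.1)%:E)%E /\ ((ratr pq.2)%:E <= V w)%E)}.
  case: pq => p' q' /=; move: (ratr p') (ratr q') => p q {p' q'}.
  have [pq|] := ltP p q; last by move=> _; apply: aeW.
  have [p0|] := leP 0 p; last by move=> _; apply: aeW.
  pose A := [set w | (Z w <= p%:E)%E] `&` [set w | (q%:E <= V w)%E].
  have GA : G.-sigma.-measurable A.
    apply: measurableI.
      by rewrite -[X in measurable X]setTI; exact: emeasurable_fun_infty_c.
    by rewrite -[X in measurable X]setTI; exact: emeasurable_fun_c_infty.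
  have mA := Gm GA.
  have qA : (q%:E * P A <= \int[P]_(w in A) V w)%E.
    rewrite -integral_cst//; apply: ge0_le_integral => //.
    - by move=> w _; rewrite lee_fin; lra.
    - exact: measurable_funTS.
    - by move=> w [].
  have Ap : (\int[P]_(w in A) Z w <= p%:E * P A)%E.
    rewrite -integral_cst//; apply: ge0_le_integral => //.
    - exact: measurable_funTS.
    - by move=> w [].
  have PA0 : P A = 0%E.
    have := le_trans qA (le_trans (VZ _ GA) Ap).
    have fA : P A \is a fin_num by exact: fin_num_measure.
    rewrite -(fineK fA) -!EFinM lee_fin => h.
    have : 0 <= fine (P A) by rewrite fine_ge0.
    by move=> ?; congr EFin; nra.
  exists A; split => // w /= /not_implyP[_] /not_implyP[_] /contrapT [].
  by split.
have := ae_forall_count key; apply: filterS => w kw.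
rewrite leNgt; apply/negP => ZV.
have Zf : Z w \is a fin_num by rewrite ge0_fin_numE// (lt_le_trans ZV)// leey.
(* A finite [q] is needed even where [V w] is infinite, so that rationals can be inserted below
   it. *)
have [q [qV Zq]] : exists q : R, (q%:E <= V w)%E /\ fine (Z w) < q.
  move: ZV; rewrite -(fineK Zf); case: (V w) (V0 w) => [v| |]//= _.
    by rewrite lte_fin => ?; exists v.
  by move=> _; exists (fine (Z w) + 1); rewrite leey ltrDl.
have [p1 p1I] := rat_in_itvoo Zq; move: p1I; rewrite in_itv/= => /andP[Zp1 p1q].
have [p2 p2I] := rat_in_itvoo p1q; move: p2I; rewrite in_itv/= => /andP[p12 p2q].
apply: (kw (p1, p2)) => //=.
  by apply: le_trans (ltW Zp1); rewrite fine_ge0.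
split; first by rewrite -(fineK Zf) lee_fin ltW.
by apply: le_trans qV; rewrite lee_fin ltW.
Qed.

End conditional.

Section cond_distribution.
Context {d} {Omega : measurableType d} {R : realType} (P : probability Omega R).
Variable G : set (set Omega).
Hypothesis Gm : G.-sigma.-measurable `<=` d.-measurable.
Import HBNNSimple.

Lemma measurable_kernel_integral (kappa : R.-pker (g_sigma_algebraType G) ~> R) (h : R -> \bar R) :
  measurable_fun setT h -> (forall x, 0 <= h x)%E ->
  measurable_fun setT ((fun w => \int[kappa w]_x h x)%E : g_sigma_algebraType G -> \bar R).
Proof.
move=> mh h0; apply: measurable_fun_integral_kernel => // B mB.
exact: measurable_kernel.
Qed.

(** Both sides agree on simple functions by the defining property of [kappa]. Taking the limit on
    the left alone yields the inequality, since each simple approximation lies below [th]. *)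
Lemma cond_distribution_integral (X : Omega -> R)
    (kappa : R.-pker (g_sigma_algebraType G) ~> R) (th : R -> \bar R) (A : set Omega) :
  is_cond_distribution P X kappa -> measurable_fun setT X ->
  measurable_fun setT th -> (forall x, 0 <= th x)%E -> G.-sigma.-measurable A ->
  (\int[P]_(w in A) th (X w) <= \int[P]_(w in A) \int[kappa w]_x th x)%E.
Proof.
move=> hk mX mth th0 GA; have mA := Gm GA.
pose s := nnsfun_approx measurableT mth.
have s_th m x : ((s m x)%:E <= th x)%E.
  have nd : {homo (fun m => (s m x)%:E) : m m' / (m <= m')%N >-> (m <= m')%E}.
    by move=> a b ab; rewrite lee_fin; exact/lefP/nd_nnsfun_approx.
  have cv : (s m' x)%:E @[m' --> \oo] --> th x by exact: cvg_nnsfun_approx.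
  have -> := cvg_unique (@ereal_hausdorff R) cv (ereal_nondecreasing_cvgn nd).
  by apply: ereal_sup_ubound; exists m.
have mXs m : measurable_fun A (fun w => (s m (X w))%:E).
  apply: measurable_funTS; apply/measurable_EFinP.
  exact: measurableT_comp mX.
have mK (h : R -> \bar R) : measurable_fun setT h -> (forall x, 0 <= h x)%E ->
    measurable_fun A (fun w => \int[kappa w]_x h x)%E.
  move=> mh h0; apply: measurable_funTS.
  have h1 := measurable_kernel_integral kappa mh h0.
  by move=> _ B mB; apply: Gm; exact: h1.
have ms m r : measurable (s m @^-1` [set r]) by exact: measurable_funPTI.
have mkap (B : set R) : measurable B -> measurable_fun [set: Omega] (fun w => kappa w B).
  by move=> mB _ C mC; apply: Gm; exact: measurable_kernel.
have simple m : (\int[P]_(w in A) (s m (X w))%:E =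
    \int[P]_(w in A) \int[kappa w]_x (s m x)%:E)%E.
  under eq_integral do rewrite fimfunE -fsumEFin//.
  rewrite ge0_integral_fsum//; last 2 first.
  - move=> r; apply: measurable_funTS; apply/measurable_EFinP.
    apply: measurable_funM => //; apply: (measurableT_comp _ mX).
    exact: measurable_indic.
  - by move=> r w _; rewrite EFinM nnfun_muleindic_ge0.
  under [in RHS]eq_integral => w _.
    under eq_integral do rewrite fimfunE -fsumEFin//.
    rewrite ge0_integral_fsum//; last 2 first.
      by move=> r; apply/measurable_EFinP; apply: measurable_funM => //; exact: measurable_indic.
      by move=> r y _; rewrite EFinM nnfun_muleindic_ge0.
    under eq_fsbigr => r _.
      rewrite (integralZl_indic _ (fun r => s m @^-1` [set r]))//; last first.
        by move=> r0; rewrite preimage_nnfun0.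
      rewrite integral_indic// setIT.
      over.
    over.
  rewrite /= ge0_integral_fsum//; last 2 first.
  - move=> r; apply: measurable_funTS; apply: measurable_funeM.
    exact: mkap.
  - move=> r w _; have := mulemu_ge0 (fun r => s m @^-1` [set r]).
    by apply; exact: preimage_nnfun0.
  apply: eq_fsbigr => r _.
  have [r0|r0] := leP 0 r; last first.
    rewrite integral0_eq ?integral0_eq// => w _.
      by rewrite preimage_nnfun0// indic0 mulr0.
    by rewrite preimage_nnfun0// measure0 mule0.
  rewrite (integralZl_indic _ (fun r => X @^-1` (s m @^-1` [set r])))//; last 2 first.
  - by move=> r0'; rewrite preimage_nnfun0// preimage_set0.
  - by rewrite -[X in measurable X]setTI; exact: mX.
  rewrite ge0_integralZl//; last first.
    apply: measurable_funTS; exact: mkap.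
  rewrite (hk A _ GA (ms m r)) integral_indic//; last first.
    by rewrite -[X in measurable X]setTI; exact: mX.
  by rewrite setIC.
have lim_s : (\int[P]_(w in A) (s m (X w))%:E)%E @[m --> \oo] --> (\int[P]_(w in A) th (X w))%E.
  have -> : (\int[P]_(w in A) th (X w) = \int[P]_(w in A) limn (fun m => (s m (X w))%:E))%E.
    apply: eq_integral => w _; apply/esym/cvg_lim => //.
    exact: (cvg_nnsfun_approx measurableT mth).
  apply: cvg_monotone_convergence => //.
  - by move=> m w _; rewrite lee_fin.
  - by move=> w _ a b ab; rewrite lee_fin; exact/lefP/nd_nnsfun_approx.
rewrite -(cvg_lim _ lim_s)//; apply: lime_le; first by apply/cvg_ex; eexists; exact: lim_s.
apply: nearW => m; rewrite simple; apply: ge0_le_integral => //.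
- by move=> w _; apply: integral_ge0 => x _; rewrite lee_fin.
- apply: mK => [|x]; last by rewrite lee_fin.
  by apply/measurable_EFinP.
- exact: mK.
- move=> w _; apply: ge0_le_integral => //.
    by move=> x _; rewrite lee_fin.
  exact/measurable_EFinP.
Qed.
End cond_distribution.

Section coordinate_conditioning.
Context {R : realType} {d dY : measure_display} {Omega : measurableType d}
  {T : measurableType dY} {P : probability Omega R} {n : nat}.
Variable Y : 'I_n -> {RV P >-> T}.
Hypothesis indepY : mutually_independent Y.
Implicit Types (F : n.-tuple T -> \bar R) (y : n.-tuple T) (k j : 'I_n).

Local Notation Yv := (random_vector Y).

Lemma probability_inhabited : exists w : Omega, True.
Proof.
apply: contrapT => /forallNP h.
have : P setT = 0%E.
  rewrite (_ : setT = set0) ?measure0//.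
  by apply/seteqP; split => // w _; exact: (h w).
by rewrite probability_setT => /eqP; rewrite onee_eq0.
Qed.

Lemma sigma_except_sub k : (sigma_except Y k).-sigma.-measurable `<=` d.-measurable.
Proof.
(* [sigma_except] is already a generated sigma-algebra and [.-sigma] generates once more, hence the
   repetition. *)
apply: smallest_sub; first exact: sigma_algebra_measurable.
apply: smallest_sub; first exact: sigma_algebra_measurable.
move=> A [j jk [B mB <-]]; exact: measurable_funPT.
Qed.

Lemma sigma_except_gen k j (B : set T) : j != k -> measurable B ->
  (sigma_except Y k).-sigma.-measurable (Y j @^-1` B).
Proof.
move=> jk mB; apply: sub_sigma_algebra; apply: sub_sigma_algebra; exists j => //.
by exists B => //; rewrite setTI.
Qed.

Lemma measurable_forget k (t : T) : measurable_fun setT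
  ((fun w => set_coord (Yv w) k t) : g_sigma_algebraType (sigma_except Y k) -> n.-tuple T).
Proof.
apply/measurable_fun_tnthP => j.
rewrite (_ : _ \o _ = if j == k then cst t else Y j); last first.
  by apply/funext => w /=; rewrite !tnth_mktuple; case: eqP.
case: eqP => [_|/eqP jk]; first exact: measurable_cst.
by move=> _ B mB; rewrite setTI; exact: sigma_except_gen.
Qed.

(** Preimages under the vector with coordinate [k] frozen at [t] form a sigma-algebra containing the
    generators. An event of [sigma_except Y k] is thus insensitive to coordinate [k]. *)
Lemma sigma_exceptP k (t : T) (A : set Omega) : (sigma_except Y k).-sigma.-measurable A ->
  exists2 B : set (n.-tuple T), measurable B & A = (fun w => set_coord (Yv w) k t) @^-1` B.
Proof.
pose h w := set_coord (Yv w) k t.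
suff : (sigma_except Y k).-sigma.-measurable `<=` preimage_set_system setT h measurable.
  by move=> sub /sub [B mB <-]; exists B => //; rewrite setTI.
have sA : sigma_algebra setT (preimage_set_system setT h measurable).
  by apply: sigma_algebra_preimage; exact: sigma_algebra_measurable.
apply: smallest_sub => //; apply: smallest_sub => // A' [j jk [B mB <-]].
exists (@tnth n T ^~ j @^-1` B).
  by rewrite -[X in measurable X]setTI; exact: measurable_tnth.
apply/seteqP; split => w [_]; rewrite /h /= !tnth_mktuple (negbTE (jk : j != k));
  by split.
Qed.

Definition coord_integral k F y : \bar R := (\int[P]_w F (set_coord y k (Y k w)))%E.

Lemma coord_integral_ge0 k F y : (forall y, 0 <= F y)%E -> (0 <= coord_integral k F y)%E.
Proof. by move=> F0; exact: integral_ge0. Qed.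

Lemma coord_integral_measurable k F : measurable_fun setT F -> (forall y, 0 <= F y)%E ->
  measurable_fun setT
   ((fun w => coord_integral k F (Yv w)) : g_sigma_algebraType (sigma_except Y k) -> \bar R).
Proof.
move=> mF F0; have [w0 _] := probability_inhabited.
rewrite (_ : (fun w => _) = coord_integral k F \o (fun w => set_coord (Yv w) k (Y k w0))).
  apply: measurableT_comp; last exact: measurable_forget.
  exact: (measurable_coord_integral Y k mF F0).
by apply/funext => w; apply: eq_integral => w' _; rewrite set_coord_idem.
Qed.

(** The indicator of [A] ignores coordinate [k], so it moves into the inner integral and
    [resample_integral] applies. Integrating out coordinate [k] is therefore a version of the
    conditional expectation. *)
Lemma coord_integral_cond k F (A : set Omega) :
  measurable_fun setT F -> (forall y, 0 <= F y)%E ->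
  (sigma_except Y k).-sigma.-measurable A ->
  (\int[P]_(w in A) coord_integral k F (Yv w) = \int[P]_(w in A) F (Yv w))%E.
Proof.
move=> mF F0; have [w0 _] := probability_inhabited.
move=> /(sigma_exceptP (Y k w0)) [B mB ->].
pose B' : set (n.-tuple T) := (fun y => set_coord y k (Y k w0)) @^-1` B.
have mB' : measurable B'.
  rewrite -[X in measurable X]setTI; apply: measurable_set_coord => //.
have B'E y t : B' (set_coord y k t) = B' y by rewrite /B' /= set_coord_idem.
have mFB : measurable_fun setT (F \_ B').
  by apply/(measurable_restrict _ _ _) => //; apply: measurable_funTS.
have FB0 y : (0 <= (F \_ B') y)%E by rewrite /patch; case: ifP.
have E := resample_integral indepY k mFB FB0.
rewrite [LHS]integral_mkcond [RHS]integral_mkcond.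
transitivity (\int[P]_w (F \_ B') (Yv w))%E; last first.
  by apply: eq_integral => w _; rewrite /patch; congr (if _ then _ else _).
rewrite -E; apply: eq_integral => w _; rewrite /patch.
case: ifPn => wB; apply/esym.
  apply: eq_integral => w' _; rewrite ifT// inE /= B'E.
  by move: wB; rewrite inE.
rewrite integral0_eq// => w' _; rewrite ifF//; apply: contraNF wB.
by rewrite !inE /= B'E.
Qed.

End coordinate_conditioning.

Section conditional_bounds.
Context {R : realType} {d dY : measure_display} {Omega : measurableType d}
  {T : measurableType dY} {P : probability Omega R} {n : nat}.
Variable Y : 'I_n -> {RV P >-> T}.
Hypothesis indepY : mutually_independent Y.
Variable f : n.-tuple T -> R.
Hypothesis mf : measurable_fun [set: n.-tuple T] f.
Implicit Types (y : n.-tuple T) (k j : 'I_n).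

Local Notation Yv := (random_vector Y).

Lemma measurable_coord_diff k : measurable_fun [set: n.-tuple T] (coord_diff Y f k).
Proof.
rewrite (_ : coord_diff Y f k = fun y => f y - coord_mean Y k f y).
  by apply: measurable_funB => //; exact: measurable_coord_mean.
by apply/funext => y; exact: coord_diffE.
Qed.

Lemma measurable_coord_diff_vector k :
  measurable_fun [set: Omega] (fun w => coord_diff Y f k (Yv w)).
Proof. exact: measurableT_comp (measurable_coord_diff k) (measurable_random_vector Y). Qed.

Lemma orlicz_psi_ge0 (alpha x : R) : 0 <= orlicz_psi alpha x.
Proof. by rewrite subr_ge0 -[leLHS]expR0 ler_expR powR_ge0. Qed.

Lemma orlicz_psi_le (alpha x t t' : R) : 0 <= alpha -> 0 <= x -> 0 < t' -> t' <= t ->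
  orlicz_psi alpha (x / t) <= orlicz_psi alpha (x / t').
Proof.
move=> a0 x0 t0 tt; have tp : 0 < t := lt_le_trans t0 tt.
rewrite lerD2r ler_expR ge0_ler_powR ?nnegrE ?divr_ge0 ?(ltW t0) ?(ltW tp)//.
by rewrite ler_wpM2l// lef_pV2.
Qed.

Lemma orlicz_norm_ge0 (alpha : R) d' (S : measurableType d') (Q : {measure set S -> \bar R})
  (X : S -> R) : (0 <= orlicz_norm alpha Q X)%E.
Proof.
by apply: le_ereal_inf_tmp => _ [t [t0 _] <-]; rewrite lee_fin ltW.
Qed.

Lemma local_variance_le k (Z : Omega -> \bar R) :
  is_cond_expectation_ge0 P (sigma_except Y k) (fun w => coord_diff Y f k (Yv w) ^+ 2) Z ->
  {ae P, forall w, (\int[P]_w' (coord_diff Y f k (set_coord (Yv w) k (Y k w')) ^+ 2)%:E <= Z w)%E}.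
Proof.
move=> [mZ Z0 ZE].
pose F y := (coord_diff Y f k y ^+ 2)%:E.
have mF : measurable_fun setT F.
  apply/measurable_EFinP.
  exact: measurableT_comp (exprn_measurable 2) (measurable_coord_diff k).
have F0 y : (0 <= F y)%E by rewrite lee_fin sqr_ge0.
suff h : {ae P, forall w, (coord_integral Y k F (Yv w) <= Z w)%E} by exact: h.
apply: (ae_le_integral_sub (@sigma_except_sub _ _ _ _ _ _ _ Y k)
  (coord_integral_measurable (k := k) mF F0) mZ) => //.
  by move=> w; exact: coord_integral_ge0.
by move=> A GA; rewrite (coord_integral_cond indepY mF F0 GA) (ZE _ GA).
Qed.

(** Each fixed level costs a null set, so the comparison with the kernel is made at rational levels
    only. [U w < t] provides an admissible [t1 < t]; a rational in between suffices, as [orlicz_psi]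
    does not increase with the level. *)
Lemma local_orlicz_le k (alpha : R) (U : Omega -> \bar R) : 1 <= alpha ->
  is_cond_orlicz_norm P alpha (sigma_except Y k) (fun w => coord_diff Y f k (Yv w)) U ->
  {ae P, forall w, forall t : R, (U w < t%:E)%E ->
    (\int[P]_w' (orlicz_psi alpha (`|coord_diff Y f k (set_coord (Yv w) k (Y k w'))| / t))%:E
       <= 1)%E}.
Proof.
move=> a1 [kappa hk UE].
pose th (t x : R) := (orlicz_psi alpha (`|x| / t))%:E.
have mth t : measurable_fun setT (th t).
  apply/measurable_EFinP; apply: (measurableT_comp (measurable_orlicz_psi alpha)).
  by apply: measurable_funM => //; exact: measurableT_comp.
have th0 t x : (0 <= th t x)%E by rewrite lee_fin orlicz_psi_ge0.
pose F t y := th t (coord_diff Y f k y).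
have mF t : measurable_fun setT (F t) by exact: measurableT_comp (mth t) (measurable_coord_diff k).
have F0 t y : (0 <= F t y)%E by exact: th0.
have sub := @sigma_except_sub _ _ _ _ _ _ _ Y k.
have key (q : rat) : {ae P, forall w, (coord_integral Y k (F (ratr q)) (Yv w) <=
    \int[kappa w]_x th (ratr q) x)%E}.
  apply: (ae_le_integral_sub sub (coord_integral_measurable (k := k) (mF _) (F0 _))
    (measurable_kernel_integral kappa (mth _) (th0 _))).
  - by move=> w; exact: coord_integral_ge0.
  - by move=> w; exact: integral_ge0.
  move=> A GA; rewrite (coord_integral_cond indepY (mF _) (F0 _) GA).
  exact: (cond_distribution_integral sub hk (measurable_coord_diff_vector k) (mth _) (th0 _) GA).
have := ae_forall_count key; apply: filterS => w kw t.
rewrite UE => /ereal_inf_lt [_ [t1 [t1_gt0 t1le] <-]]; rewrite lte_fin => t1t.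
have [q] := rat_in_itvoo t1t; rewrite in_itv/= => /andP[t1q qt].
have q0 : 0 < ratr q :> R := lt_trans t1_gt0 t1q.
have a0 : 0 <= alpha := le_trans ler01 a1.
have thle1 x : (th t x <= th (ratr q) x)%E.
  by rewrite lee_fin; exact: orlicz_psi_le a0 (normr_ge0 _) q0 (ltW qt).
have thle2 x : (th (ratr q) x <= th t1 x)%E.
  by rewrite lee_fin; exact: orlicz_psi_le a0 (normr_ge0 _) t1_gt0 (ltW t1q).
have c1 : (coord_integral Y k (F t) (Yv w) <= coord_integral Y k (F (ratr q)) (Yv w))%E.
  apply: ge0_le_integral => [//|w' _|||w' _]; [exact: F0|..|exact: thle1].
  - exact: measurableT_comp (mF t) (measurable_resample Y (Yv w) k).
  - exact: measurableT_comp (mF _) (measurable_resample Y (Yv w) k).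
have c3 : (\int[kappa w]_x th (ratr q) x <= \int[kappa w]_x th t1 x)%E.
  by apply: ge0_le_integral => [//|x _|||x _]; [exact: th0|exact: mth|exact: mth|exact: thle2].
exact: le_trans c1 (le_trans (kw q) (le_trans c3 t1le)).
Qed.

Lemma integrable_coord_diff k (Z : Omega -> \bar R) (c : R) :
  is_cond_expectation_ge0 P (sigma_except Y k) (fun w => coord_diff Y f k (Yv w) ^+ 2) Z ->
  {ae P, forall w, (Z w <= c%:E)%E} ->
  P.-integrable setT (EFin \o (fun w => coord_diff Y f k (Yv w))).
Proof.
move=> [mZ Z0 ZE] Zc.
have mX := measurable_coord_diff_vector k.
have mX2 : measurable_fun setT (fun w => coord_diff Y f k (Yv w) ^+ 2).
  exact: measurableT_comp (exprn_measurable 2) mX.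
have i2 : P.-integrable setT (EFin \o (fun w => coord_diff Y f k (Yv w) ^+ 2)).
  apply: ge0_integrable => // [w|]; first exact: sqr_ge0.
  rewrite -(ZE setT) //.
  apply: (@le_lt_trans _ _ (\int[P]_w `|c|%:E)%E).
    apply: ae_ge0_le_integral => //.
    - apply: (measurable_fun_sub (@sigma_except_sub _ _ _ _ _ _ _ Y k)); exact: mZ.
    - apply: filterS Zc => w cw _; apply: le_trans cw _.
      by rewrite lee_fin ler_norm.
  by rewrite integral_cst//= probability_setT mule1 ltry.
have i1 := integrableDr (integrable_cst P 1) i2.
apply: (le_integrable measurableT _ _ i1); first exact/measurable_EFinP.
move=> w _ /=; rewrite lee_fin [leRHS]ger0_norm ?addr_ge0 ?sqr_ge0//.
set x := coord_diff _ _ _ _; rewrite -(real_normK (num_real x)).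
by have := sqr_ge0 (`|x| - 1); have := normr_ge0 x; nra.
Qed.

Lemma integrable_mix_diff k (J : {set 'I_n}) :
  P.-integrable setT (EFin \o (fun w => coord_diff Y f k (Yv w))) ->
  (P \x P)%E.-integrable setT
    (EFin \o (fun z : Omega * Omega => coord_diff Y f k (mix J (Yv z.1) (Yv z.2)))).
Proof.
move=> /integrableP[_ fi]; apply/integrableP; split.
  apply/measurable_EFinP; apply: (measurableT_comp (measurable_coord_diff k)).
  exact: measurable_mix_vector.
pose F y := `|(coord_diff Y f k y)%:E|%E.
have mF : measurable_fun setT F.
  by apply: measurableT_comp => //; apply/measurable_EFinP; exact: measurable_coord_diff.
have := eq_law_integral (measurable_mix_vector Y J) (measurable_random_vector Y)
  (mix_law indepY J) mF (fun y => abse_ge0 _).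
by rewrite /F /= => ->.
Qed.

(* [f (Y) - f (Y')] telescopes over the coordinates replaced one at a time. *)
Lemma integrable_vector :
  (forall k, P.-integrable setT (EFin \o (fun w => coord_diff Y f k (Yv w)))) ->
  P.-integrable setT (EFin \o (fun w => f (Yv w))).
Proof.
move=> idiff.
pose W (J : {set 'I_n}) (z : Omega * Omega) := mix J (Yv z.1) (Yv z.2).
have mW J : measurable_fun setT (W J) by exact: measurable_mix_vector.
have step (s : seq 'I_n) : (P \x P)%E.-integrable setT
    (EFin \o (fun z => f (W finset.set0 z) - f (W [set x in s]%SET z))).
  elim: s => [|k s IH].
    have -> : [set x in [::]]%SET = finset.set0 :> {set 'I_n} by apply/setP => x; rewrite !inE.
    under eq_fun do rewrite /= subrr.
    exact: integrable0.
  set J := [set x in s]%SET in IH *.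
  have [ks|ks] := boolP (k \in s).
    have -> : [set x in k :: s]%SET = J.
      by apply/setP => x; rewrite !inE; case: eqP => // ->.
    exact: IH.
  have W'E z : W [set x in k :: s]%SET z = set_coord (W J z) k (Y k z.2).
    apply: eq_from_tnth => j; rewrite !tnth_mktuple !inE.
      by case: (eqVneq j k) => // ->.
  (* The two vectors differ only in coordinate [k], so their [coord_mean] terms cancel and the
     increment of [f] is a difference of two [coord_diff]s. *)
  have i1 := integrable_mix_diff J (idiff k).
  have i2 := integrable_mix_diff [set x in k :: s]%SET (idiff k).
  have i3 := integrableD measurableT IH (integrableB measurableT i1 i2).
  apply: eq_integrable i3 => // z _ /=.
  rewrite -EFinB -EFinD; congr EFin; rewrite -/(W J z) -/(W _ z) W'E !coord_diffE.
  by rewrite coord_mean_set_coord; lra.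
have {step} := step (enum 'I_n).
have W0 z : W finset.set0 z = Yv z.1 by apply: eq_from_tnth => j; rewrite tnth_mktuple inE.
have WT z : W [set x in enum 'I_n]%SET z = Yv z.2.
  by apply: eq_from_tnth => j; rewrite tnth_mktuple inE mem_enum.
(* By Fubini almost every section in the second copy is integrable; fixing one turns [f (Y')] into a
   constant. *)
move=> /ae_integrable2 ae2.
have [w' iw'] : exists w', P.-integrable setT (EFin \o (fun w => f (Yv w) - f (Yv w'))).
  have PF : ProperFilter (almost_everywhere P).
    by apply: ae_properfilter_algebraOfSetsType; rewrite /= probability_setT.
  have [w' h] := filter_ex ae2; exists w'; apply: eq_integrable h => // w _ /=.
  by rewrite W0 WT.
have := integrableDr iw' (integrable_cst P (f (Yv w'))).
by apply: eq_integrable => // w _ /=; rewrite subrK.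
Qed.

End conditional_bounds.

(** * The exponential moment bound and the choice of parameters *)

Section local_bound.
Context {R : realType} {d dY : measure_display} {Omega : measurableType d}
  {T : measurableType dY} {P : probability Omega R} {n : nat}.
Variable Y : 'I_n -> {RV P >-> T}.
Variable f : n.-tuple T -> R.
Hypothesis mf : measurable_fun [set: n.-tuple T] f.
Implicit Types (y : n.-tuple T) (k : 'I_n).

Lemma Phi_scaled_tangent (s x x' : R) :
  Phi (s * x) + s * dPhi (s * x) * (x' - x) <= Phi (s * x').
Proof. by have := Phi_tangent (s * x) (s * x'); lra. Qed.

Lemma local_PhiE (g : n.-tuple T -> R) (s : R) k y : local_Phi Y g s k y =
  \int[P]_w Phi (s * (g (set_coord y k (Y k w)) - coord_mean Y k g y)).
Proof. by apply: eq_Rintegral => w _; rewrite coord_mean_set_coord. Qed.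

(** With the other coordinates fixed, [clip_convex_order] trades the clipped coordinate for the
    original one centred at its own mean. That is [coord_diff], to which the hypotheses apply. *)
Lemma local_Phi_clip_le (alpha tau K M s U s2 : R) k y :
  1 <= alpha -> 4 <= tau -> 0 <= U -> U <= K -> 0 < K -> 0 <= s -> 0 <= M ->
  s * (K * tau `^ alpha^-1) <= alpha * tau / 2 ->
  coord_mean_defined Y f k y ->
  (\int[P]_w (coord_diff Y f k (set_coord y k (Y k w)) ^+ 2)%:E <= s2%:E)%E ->
  (forall t : R, U < t -> (\int[P]_w
    (orlicz_psi alpha (`|coord_diff Y f k (set_coord y k (Y k w))| / t))%:E <= 1)%E) ->
  local_Phi Y (fun y' => clip M (f y')) s k y <=
  s ^+ 2 / 2 * expR (s * (K * tau `^ alpha^-1)) *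
    (s2 + s * (K * tau `^ alpha^-1) / 2 * expR (2 - tau / 2) * U ^+ 2).
Proof.
move=> a1 t4 U0 UK K0 s0 M0 uat iX X2 XU.
pose X w := f (set_coord y k (Y k w)).
have mX : measurable_fun setT X by exact: measurableT_comp mf (measurable_resample Y y k).
have XE w : coord_diff Y f k (set_coord y k (Y k w)) = X w - \int[P]_w' X w'.
  by rewrite coord_diffE coord_mean_set_coord.
have mXc : measurable_fun setT (fun w => X w - \int[P]_w' X w') by exact: measurable_funB.
have bA : bmeas (fun w => clip M (X w)) by exact: bmeas_clip.
rewrite -lee_fin.
have -> : (local_Phi Y (fun y' => clip M (f y')) s k y)%:E =
    (\int[P]_w (Phi (s * (clip M (X w) - \int[P]_w' clip M (X w'))))%:E)%E.
  rewrite local_PhiE EFin_mean//.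
  apply: bmeas_integrable; apply: bmeas_Phi; apply: bmeasZ; apply: bmeasB => //.
  exact: bmeas_cst.
apply: le_trans (clip_convex_order (P := P) (F := fun x => Phi (s * x))
  (p := fun x => s * dPhi (s * x)) (X := X) (M := M) _ _ _ _ M0 mX iX) _.
- by move=> x; exact: Phi_ge0.
- by apply: (measurableT_comp measurable_Phi); exact: measurable_funM.
- exact: Phi_scaled_tangent.
- by move=> x x' xx'; rewrite ler_wpM2l// dPhi_homo// ler_wpM2l.
have X2' : (\int[P]_w ((X w - \int[P]_w' X w') ^+ 2)%:E <= s2%:E)%E.
  by under eq_integral do rewrite -XE.
have XU' (t : R) : U < t ->
    (\int[P]_w (orlicz_psi alpha (`|X w - \int[P]_w' X w'| / t))%:E <= 1)%E.
  by move=> Ut; under eq_integral do rewrite -XE; exact: XU.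
exact: (integral_Phi_le a1 t4 U0 UK K0 s0 uat mXc X2' XU').
Qed.

End local_bound.

Section mgf_bound.
Context {R : realType} {d dY : measure_display} {Omega : measurableType d}
  {T : measurableType dY} {P : probability Omega R} {n : nat}.
Variables (Y : 'I_n -> {RV P >-> T}) (f : n.-tuple T -> R).
Variables (alpha K sigma U tau : R) (U_ sigma2_ : 'I_n -> Omega -> \bar R).
Hypothesis a1 : 1 <= alpha.
Hypothesis indepY : mutually_independent Y.
Hypothesis mf : measurable_fun [set: n.-tuple T] f.
Hypothesis defined : forall i, {ae P, forall w, coord_mean_defined Y f i (random_vector Y w)}.
Hypothesis orliczU : forall i, is_cond_orlicz_norm P alpha (sigma_except Y i)
     (fun w => coord_diff Y f i (random_vector Y w)) (U_ i).
Hypothesis varS : forall i, is_cond_expectation_ge0 P (sigma_except Y i)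
     (fun w => coord_diff Y f i (random_vector Y w) ^+ 2) (sigma2_ i).
Hypotheses (K0 : 0 < K) (t4 : 4 <= tau) (tauU : expR (2 - tau / 2) * U ^+ 2 <= sigma ^+ 2).
Hypothesis maxK : {ae P, forall w, (\big[maxe/-oo]_(k < n) U_ k w <= K%:E)%E}.
Hypothesis sumU : {ae P, forall w, (\sum_(k < n) U_ k w ^+ 2 <= (U ^+ 2)%:E)%E}.
Hypothesis sumS : {ae P, forall w, (\sum_(k < n) sigma2_ k w <= (sigma ^+ 2)%:E)%E}.

Local Notation Yv := (random_vector Y).
Local Notation b := (K * tau `^ alpha^-1).

Lemma ae_sum_local_Phi_le (M s : R) : 0 <= M -> 0 <= s -> s * b <= alpha * tau / 2 ->
  {ae P, forall w, \sum_(k < n) local_Phi Y (fun y => clip M (f y)) s k (Yv w) <=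
    s ^+ 2 / 2 * (sigma ^+ 2 * expR (3 / 2 * (s * b)))}.
Proof.
move=> M0 s0 sb.
have a_def := ae_forall_count (I := 'I_n) defined.
have a_orl := ae_forall_count (I := 'I_n) (fun k => local_orlicz_le indepY mf a1 (orliczU k)).
have a_var := ae_forall_count (I := 'I_n) (fun k => local_variance_le indepY mf (varS k)).
have aeI (A B : set Omega) : {ae P, forall w, A w} -> {ae P, forall w, B w} ->
  {ae P, forall w, (A `&` B) w} by exact: filterI.
have := aeI _ _ a_def (aeI _ _ a_orl (aeI _ _ a_var (aeI _ _ maxK (aeI _ _ sumU sumS)))).
apply: filterS => w [hdef [horl [hvar [hmax [hU hS]]]]].
have U0 k : (0 <= U_ k w)%E.
  by have [kappa _ ->] := orliczU k; exact: orlicz_norm_ge0.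
have S0 k : (0 <= sigma2_ k w)%E by case: (varS k).
have UK k : (U_ k w <= K%:E)%E by apply: le_trans hmax; exact: le_bigmax.
have Uf k : U_ k w \is a fin_num.
  by rewrite ge0_fin_numE// (le_lt_trans (UK k)) ?ltry.
have Sf k : sigma2_ k w \is a fin_num.
  rewrite ge0_fin_numE// (le_lt_trans _ (le_lt_trans hS (ltry _)))//.
  by rewrite (bigD1 k)//= leeDl// sume_ge0.
pose u k := fine (U_ k w); pose v k := fine (sigma2_ k w).
have uE k : U_ k w = (u k)%:E by rewrite fineK.
have vE k : sigma2_ k w = (v k)%:E by rewrite fineK.
have sumu : \sum_(k < n) u k ^+ 2 <= U ^+ 2.
  rewrite -lee_fin -sumEFin; apply: le_trans hU.
  by apply: lee_sum => k _; rewrite uE EFin_expe.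
have sumv : \sum_(k < n) v k <= sigma ^+ 2.
  by rewrite -lee_fin -sumEFin; apply: le_trans hS; apply: lee_sum => k _; rewrite vE.
have b0 : 0 < b by rewrite mulr_gt0// powR_gt0// (lt_le_trans _ t4).
have sb0 : 0 <= s * b by rewrite mulr_ge0// ltW.
apply: (@le_trans _ _ (\sum_(k < n) (s ^+ 2 / 2 * expR (s * b) *
    (v k + s * b / 2 * expR (2 - tau / 2) * u k ^+ 2)))).
  apply: ler_sum => k _; apply: local_Phi_clip_le => //.
  - by rewrite fine_ge0.
  - by rewrite -lee_fin -uE.
  - by rewrite -vE; exact: hvar.
  - by move=> t ut; apply: horl; rewrite uE lte_fin.
rewrite -mulr_sumr big_split/= -mulr_sumr -mulrA ler_wpM2l ?divr_ge0 ?sqr_ge0//.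
(* The extra [s b / 2] in the exponent absorbs the factor [1 + s b / 2], whose second term is the
   total Orlicz contribution. *)
have -> : 3 / 2 * (s * b) = s * b + s * b / 2 by lra.
rewrite (expRD (s * b)) [leRHS]mulrCA ler_wpM2l ?expR_ge0//.
apply: (@le_trans _ _ (sigma ^+ 2 * (1 + s * b / 2))); last first.
  by rewrite ler_wpM2l ?sqr_ge0// expR_ge1Dx.
rewrite mulrDr mulr1 lerD// -mulrA mulrC.
rewrite ler_wpM2r//; first by rewrite divr_ge0.
by apply: le_trans tauU; rewrite ler_wpM2l ?expR_ge0.
Qed.

Variables (lam v B : R).
Hypotheses (lam0 : 0 < lam) (lamb : lam * b <= alpha * tau / 2) (v0 : 0 <= v)
  (B0 : 0 <= B) (Blam : B * lam < 1).
Hypothesis vB : forall s : R, 0 < s -> s <= lam ->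
  sigma ^+ 2 * expR (3 / 2 * (s * b)) <= v / (1 - B * s) ^+ 2.

(** [v] and [B] are left free so that one Herbst integration serves both conclusions: [B = 3 b / 4]
    for the Bernstein form, [B = 0] with the exponential frozen at [s = lam] for the other. *)
Lemma clip_log_mgf_le (M : R) : 0 <= M ->
  ln (\int[P]_w expR (lam * clip M (f (Yv w)))) <=
  lam * (\int[P]_w clip M (f (Yv w))) + v * lam ^+ 2 / (2 * (1 - B * lam)).
Proof.
move=> M0; pose fM y := clip M (f y).
have bfM : bmeas fM by exact: bmeas_clip.
have b0 : 0 < b by rewrite mulr_gt0// powR_gt0// (lt_le_trans _ t4).
apply: (log_mgf_le (bmeas_vector Y bfM) v0 B0 lam0 Blam) => s s0 sl.
have Bs : 0 < 1 - B * s.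
  by rewrite subr_gt0 (le_lt_trans _ Blam)// ler_wpM2l.
apply: (entropy_inequality indepY (f := fM)) => //.
  by rewrite divr_ge0// mulr_ge0 ?sqr_ge0.
have sb : s * b <= alpha * tau / 2.
  by apply: le_trans lamb; rewrite ler_wpM2r// ltW.
apply: filterS (ae_sum_local_Phi_le M0 (ltW s0) sb) => w /le_trans; apply.
have s20 : 0 <= s ^+ 2 / 2 by rewrite divr_ge0// sqr_ge0.
apply: le_trans (ler_wpM2l s20 (vB s0 sl)) _.
by rewrite le_eqVlt; apply/orP; left; apply/eqP; field; rewrite gt_eqF.
Qed.

End mgf_bound.

(** * Removal of the clipping and Chernoff's bound *)

Section clip_limit.
Context {d} {T : measurableType d} {R : realType} (P : probability T R).
Variable X : T -> R.
Hypotheses (mX : measurable_fun [set: T] X) (iX : P.-integrable [set: T] (EFin \o X)).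

Lemma cvg_clip (x : R) : clip N%:R x @[N --> \oo] --> x.
Proof.
apply: cvg_near_cst; near=> N.
have : `|x| <= N%:R.
  apply: (@le_trans _ _ (Num.bound `|x|)%:R); first exact: ltW (archi_boundP (normr_ge0 x)).
  by rewrite ler_nat; near: N; exact: nbhs_infty_ge.
rewrite ler_norml => /andP[x1 x2].
by rewrite /clip min_l// max_r.
Unshelve. all: by end_near.
Qed.

Lemma clip_norm_le (N x : R) : 0 <= N -> `|clip N x| <= `|x|.
Proof.
move=> N0; rewrite ler_norml /clip le_max ge_max le_min ge_min.
have := ler_norm x; have := ler_norm (- x); rewrite normrN.
have := normr_ge0 x; move: `|x| => a a0 h1 h2.
have [xN|xN] := leP x N; apply/andP; split; first by apply/orP; right; apply/andP; split; lra.
- by apply/andP; split; [|apply/orP; left]; lra.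
- by apply/orP; right; apply/andP; split; lra.
- by apply/andP; split; [|apply/orP; right]; lra.
Qed.

Lemma mean_clip_cvg :
  \int[P]_w clip N%:R (X w) @[N --> \oo] --> \int[P]_w X w.
Proof.
have mf N : measurable_fun setT (fun w => (clip N%:R (X w))%:E : \bar R).
  by apply/measurable_EFinP; exact: measurableT_comp (measurable_clip _) mX.
have mX' : measurable_fun setT (EFin \o X) by exact/measurable_EFinP.
have cvf : {ae P, forall w, setT w -> (clip N%:R (X w))%:E @[N --> \oo] --> (EFin \o X) w}.
  by apply: aeW => w _; apply: cvg_EFin; [exact: nearW|exact: cvg_clip].
have dom : {ae P, forall w, forall N : nat, setT w -> (`|(clip N%:R (X w))%:E| <= (abse \o (EFin \o X)) w)%E}.
  by apply: aeW => w N _; rewrite lee_fin; exact: clip_norm_le.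
have [_ _ cv] := dominated_convergence measurableT mf mX' cvf (integrable_abse iX) dom.
have mE : (\int[P]_w (X w)%:E = (\int[P]_w X w)%:E)%E by exact: EFin_mean.
by move: cv; rewrite [X in _ --> X]mE; exact: fine_cvg.
Qed.

(** [C] does not depend on [M]. The clipped variables converge pointwise and their means by
    domination, so Fatou's lemma carries the bound to the limit. *)
Lemma mgf_clip_limit (lam C : R) :
  (forall M : R, 0 <= M ->
    ln (\int[P]_w expR (lam * clip M (X w))) <= lam * (\int[P]_w clip M (X w)) + C) ->
  (\int[P]_w (expR (lam * (X w - \int[P]_w' X w')))%:E <= (expR C)%:E)%E.
Proof.
move=> hC; set m := \int[P]_w' X w'.
pose mN (N : nat) := \int[P]_w' clip N%:R (X w').
pose g N w := (expR (lam * (clip N%:R (X w) - mN N)))%:E.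
have bcl N : bmeas (fun w => clip N%:R (X w)) by exact: bmeas_clip.
have bg N : bmeas (fun w => expR (lam * (clip N%:R (X w) - mN N))).
  by apply: bmeas_expR; apply: bmeasZ; apply: bmeasB => //; exact: bmeas_cst.
have gC N : (\int[P]_w g N w <= (expR C)%:E)%E.
  rewrite EFin_mean; last exact: bmeas_integrable.
  rewrite lee_fin.
  have be : bmeas (fun w => expR (lam * clip N%:R (X w))).
    by apply: bmeas_expR; exact: bmeasZ.
  have -> : \int[P]_w expR (lam * (clip N%:R (X w) - mN N)) =
      expR (- (lam * mN N)) * \int[P]_w expR (lam * clip N%:R (X w)).
    rewrite -meanZ//; apply: eq_Rintegral => w _.
    by rewrite -expRD mulrBr addrC.
  have F0 := mgf_gt0 P (bcl N) lam.
  rewrite -[X in _ * X]lnK ?posrE// -expRD ler_expR.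
  by have := hC N%:R (ler0n _ _); rewrite -/(mN N); lra.
have lim_g w : g N w @[N --> \oo] --> (expR (lam * (X w - m)))%:E.
  apply: cvg_EFin; first exact: nearW.
  have c1 : lam * (clip N%:R (X w) - mN N) @[N --> \oo] --> lam * (X w - m).
    by apply: cvgMr; apply: cvgB; [exact: cvg_clip|exact: mean_clip_cvg].
  exact: (cvg_comp _ expR c1 (@continuous_expR R _)).
have mg N : measurable_fun setT (g N) by apply/measurable_EFinP; case: (bg N).
have g0 N w : setT w -> (0 <= g N w)%E by move=> _; rewrite lee_fin expR_ge0.
have ft := fatou P measurableT mg g0.
have gE w : (expR (lam * (X w - m)))%:E = limn_einf (g^~ w).
  by rewrite (cvg_limn_einf_sup (lim_g w)).
under eq_integral do rewrite gE.
apply: le_trans ft _; rewrite limn_einf_lim; apply: lime_le; first exact: is_cvg_einfs.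
apply: nearW => N; apply: le_trans (gC N).
by apply: ereal_inf_lbound; exists N => /=.
Qed.

Lemma mgf_tail (lam C t x m : R) : 0 < lam ->
  (\int[P]_w (expR (lam * (X w - m)))%:E <= (expR C)%:E)%E -> x <= lam * t - C ->
  ((1 - expR (- x))%:E <= P [set w | (X w - m <= t)%R])%E.
Proof.
move=> l0 hC xt.
have mXm : measurable_fun setT (fun w => X w - m) by exact: measurable_funB.
have mA : measurable [set w | X w - m <= t].
  by rewrite -[X in measurable X]setTI; exact: measurable_fun_le.
set A := [set w | _] in mA *; have mCA : measurable (~` A) by exact: measurableC.
have me : measurable_fun setT (fun w => (expR (lam * (X w - m)))%:E).
  by apply/measurable_EFinP; apply: measurableT_comp => //; exact: measurable_funM.
have h1 : ((expR (lam * t))%:E * P (~` A) <= (expR C)%:E)%E.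
  apply: le_trans hC; rewrite -integral_cst//.
  apply: (@le_trans _ _ (\int[P]_(w in ~` A) (expR (lam * (X w - m)))%:E)%E).
    apply: ge0_le_integral => //.
    - by move=> w _; rewrite lee_fin expR_ge0.
    - exact: measurable_funTS.
    - move=> w; rewrite /A /= => /negP; rewrite -ltNge => tw.
      by rewrite lee_fin ler_expR ler_wpM2l ?ltW.
  apply: ge0_subset_integral => // w _; by rewrite lee_fin expR_ge0.
have fA : P A \is a fin_num by exact: fin_num_measure.
have fCA : P (~` A) \is a fin_num by exact: fin_num_measure.
move: h1; rewrite probability_setC// -(fineK fA) -EFinB -EFinM !lee_fin => h1.
have : 1 - fine (P A) <= expR (- x).
  rewrite -(ler_pM2l (expR_gt0 (lam * t))); apply: le_trans h1 _.
  by rewrite -expRD ler_expR; lra.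
by lra.
Qed.
End clip_limit.

(** * Choice of the exponential parameter *)

Section parameters.
Variable R : realType.
Implicit Types sigma b x t : R.

(** Inversion of a sub-gamma bound: with [B = 3 b / 4] and [S^2 = 2 x], the witness
    [S / (sigma + B S)] maximises the right-hand side at [t = sigma S + B x], where the maximum is
    exactly [x]. *)
Lemma bernstein_parameter sigma b x t : 0 < sigma -> 0 < b -> 0 < x ->
  sigma * Num.sqrt (2 * x) + 3 / 4 * b * x <= t ->
  exists lam, [/\ 0 < lam, 3 / 4 * b * lam < 1 &
    x <= lam * t - sigma ^+ 2 * lam ^+ 2 / (2 * (1 - 3 / 4 * b * lam))].
Proof.
move=> s0 b0 x0; set S := Num.sqrt (2 * x); set B := 3 / 4 * b => tS.
have S0 : 0 < S by rewrite sqrtr_gt0 mulr_gt0.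
have SS : S ^+ 2 = 2 * x by rewrite sqr_sqrtr// mulr_ge0// ltW.
have B0 : 0 < B by rewrite /B mulr_gt0.
clearbody S B.
have qB : 0 < 1 + B * (S / sigma) by rewrite addr_gt0// mulr_gt0// divr_gt0.
have qB' : 0 < sigma + B * S by rewrite addr_gt0// mulr_gt0.
exists (S / (sigma + B * S)); split.
- by rewrite divr_gt0.
- by rewrite mulrA ltr_pdivrMr// mul1r ltrDr.
have h : S / (sigma + B * S) * (sigma * S + B * x) <= S / (sigma + B * S) * t.
  by rewrite ler_wpM2l// divr_ge0 ?ltW.
rewrite lerBrDr; apply: le_trans h.
have -> : 1 - B * (S / (sigma + B * S)) = sigma / (sigma + B * S).
  by field; rewrite gt_eqF.
have -> : x = S ^+ 2 / 2 by rewrite SS; lra.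
rewrite le_eqVlt; apply/orP; left; apply/eqP.
by field; rewrite !gt_eqF.
Qed.

(** With [u = D / 4] and [lam = u / b], the part [4 b x / D] of [t] contributes exactly [x], so the
    variance term must fit under [lam sigma sqrt x]. By [u <= 2 e^(u/2)] its exponent grows to
    [3 u / 2 + u / 2 = D / 2], that of the hypothesis; this explains the quarter. *)
Lemma bennett_parameter sigma b x t D : 0 < sigma -> 0 < b -> 0 < x -> 0 < D ->
  sigma * expR (D / 2) <= b * Num.sqrt x ->
  sigma * Num.sqrt (2 * x) + 4 * b * x / D <= t ->
  x <= D / 4 / b * t -
    sigma ^+ 2 * expR (3 / 2 * (D / 4)) * (D / 4 / b) ^+ 2 / (2 * (1 - 0 * (D / 4 / b))).
Proof.
move=> s0 b0 x0 D0 hD tS; set u := D / 4.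
have u0 : 0 < u by rewrite divr_gt0.
have DE : D = 4 * u by rewrite /u; lra.
rewrite mul0r subr0 mulr1.
have lt0 : 0 < u / b by rewrite divr_gt0.
have sq : Num.sqrt x <= Num.sqrt (2 * x) by rewrite ler_wsqrtr//; lra.
have h : u / b * (sigma * Num.sqrt x + b * x / u) <= u / b * t.
  rewrite ler_wpM2l ?(ltW lt0)//; apply: le_trans tS; rewrite lerD ?ler_wpM2l ?(ltW s0)//.
  by rewrite DE le_eqVlt; apply/orP; left; apply/eqP; field; rewrite gt_eqF.
rewrite lerBrDr; apply: le_trans h.
have -> : u / b * (sigma * Num.sqrt x + b * x / u) = x + u / b * (sigma * Num.sqrt x).
  by field; rewrite !gt_eqF.
rewrite lerD2l.
suff key : sigma ^+ 2 * expR (3 / 2 * u) * u <= 2 * b * (sigma * Num.sqrt x).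
  have -> : sigma ^+ 2 * expR (3 / 2 * u) * (u / b) ^+ 2 / 2 =
      sigma ^+ 2 * expR (3 / 2 * u) * u * (u / b / (2 * b)) by field; rewrite gt_eqF.
  apply: le_trans (ler_wpM2r _ key) _; first by rewrite divr_ge0 ?(ltW lt0)// mulr_ge0// ltW.
  by rewrite le_eqVlt; apply/orP; left; apply/eqP; field; rewrite gt_eqF.
have uexp : u <= 2 * expR (u / 2) by have := expR_ge1Dx (u / 2); lra.
have e2 : expR (D / 2) = expR (3 / 2 * u) * expR (u / 2).
  by rewrite -expRD DE; congr expR; lra.
apply: (@le_trans _ _ (sigma ^+ 2 * expR (3 / 2 * u) * (2 * expR (u / 2)))).
  by rewrite ler_wpM2l// mulr_ge0 ?sqr_ge0 ?expR_ge0.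
have -> : sigma ^+ 2 * expR (3 / 2 * u) * (2 * expR (u / 2)) =
    2 * sigma * (sigma * expR (D / 2)) by rewrite e2; ring.
have -> : 2 * b * (sigma * Num.sqrt x) = 2 * sigma * (b * Num.sqrt x) by ring.
by rewrite ler_wpM2l// mulr_ge0// ltW.
Qed.

(** [e^(- y) >= 1 - y] at [y = 3 b s / 4], squared and inverted; the square is why [3 / 2] in the
    exponent becomes [3 / 4]. *)
Lemma bernstein_variance (sigma b s : R) : 0 <= s -> 3 / 4 * b * s < 1 ->
  sigma ^+ 2 * expR (3 / 2 * (s * b)) <= sigma ^+ 2 / (1 - 3 / 4 * b * s) ^+ 2.
Proof.
move=> s0 bs; rewrite ler_wpM2l ?sqr_ge0//.
have p0 : 0 < 1 - 3 / 4 * b * s by lra.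
have -> : 3 / 2 * (s * b) = - (- (3 / 4 * b * s) + - (3 / 4 * b * s)) by lra.
rewrite expRN expRD -expr2 lef_pV2 ?posrE ?exprn_gt0 ?expR_gt0//.
rewrite ler_pXn2r ?nnegrE ?expR_ge0 ?(ltW p0)//.
exact: expR_ge1Dx.
Qed.
End parameters.

Theorem corollary3p6 (R : realType) (alpha : R) (d dY : measure_display)
    (Omega : measurableType d) (T : measurableType dY) (P : probability Omega R)
    (n : nat) (Y : 'I_n -> {RV P >-> T}) (f : n.-tuple T -> R)
    (U_ sigma2_ : 'I_n -> Omega -> \bar R) (U K sigma : R) :
  1 <= alpha ->
  (0 < n)%N ->
  mutually_independent Y ->
  measurable_fun [set: n.-tuple T] f ->
  (forall i, {ae P, forall w, coord_mean_defined Y f i (random_vector Y w)}) ->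
  (forall i, is_cond_orlicz_norm P alpha (sigma_except Y i)
     (fun w => coord_diff Y f i (random_vector Y w)) (U_ i)) ->
  (forall i, is_cond_expectation_ge0 P (sigma_except Y i)
     (fun w => coord_diff Y f i (random_vector Y w) ^+ 2) (sigma2_ i)) ->
  0 < K -> K <= U -> 0 < sigma ->
  {ae P, forall w, (\big[maxe/-oo]_(k < n) U_ k w <= K%:E)%E} ->
  {ae P, forall w, (\sum_(k < n) U_ k w ^+ 2 <= (U ^+ 2)%:E)%E} ->
  {ae P, forall w, (\sum_(k < n) sigma2_ k w <= (sigma ^+ 2)%:E)%E} ->
  let z : R := (4 * ln1 (expR 1 * U / sigma)) `^ alpha^-1 in
  let r : R := n.+1%:R / n%:R in
  let deviation (w : Omega) : \bar R :=
    ((f (random_vector Y w))%:E - 'E_P[f \o random_vector Y])%E in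
  forall x : R, 0 < x ->
    ((1 - expR (- x))%:E <=
       P [set w | (deviation w <=
         (sigma * Num.sqrt (2 * x * r) +
          4 * K * z * x /
            Num.min (2 * alpha * z `^ alpha)
                    (ln1 ((K * z / (sigma * r)) ^+ 2 * x)))%:E)%E])%E /\
    ((1 - expR (- x))%:E <=
       P [set w | (deviation w <=
         (sigma * Num.sqrt (2 * x * r) + 3 / 4 * K * z * x * r)%:E)%E])%E.
Proof.
move=> a1 n0 indepY mf defined orl var K0 KU s0 maxK sumU sumS z r deviation x x0.
have U0 : 0 < U := lt_le_trans K0 KU.
have a0 : 0 < alpha := lt_le_trans ltr01 a1.
pose tau := 4 * ln1 (expR 1 * U / sigma).
have [t4 tauU] : 4 <= tau /\ expR (2 - tau / 2) * U ^+ 2 <= sigma ^+ 2 by exact: ln1_tail.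
have tau0 : 0 < tau by rewrite (lt_le_trans _ t4).
have zE : z = tau `^ alpha^-1 by [].
have zalpha : z `^ alpha = tau by rewrite zE -powRrM mulVf ?gt_eqF// powRr1// ltW.
have z0 : 0 < z by rewrite zE powR_gt0.
clearbody z tau.
have b0 : 0 < K * z by rewrite mulr_gt0.
have r1 : 1 <= r by rewrite /r ler_pdivlMr ?ltr0n// mul1r ler_nat.
(* In the Bernstein case [lam b < 4 / 3], so the cap [alpha tau / 2] on [lam b] holds
   automatically. *)
have at2 : 2 <= alpha * tau / 2 by nra.
clearbody r.
pose X w := f (random_vector Y w).
have mX : measurable_fun setT X by exact: measurableT_comp mf (measurable_random_vector Y).
have iX : P.-integrable setT (EFin \o X).
  apply: (integrable_vector indepY mf) => k.
  apply: (integrable_coord_diff mf (var k) (c := sigma ^+ 2)).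
  apply: filterS sumS => w; apply: le_trans; rewrite (bigD1 k)//= leeDl// sume_ge0// => j _.
  by case: (var j).
pose m := \int[P]_w X w.
have devE w t : (deviation w <= t%:E)%E = (X w - m <= t).
  have -> : deviation w = (X w - m)%:E.
    by rewrite /deviation EFinB unlock; congr (_ - _)%E; exact: EFin_mean.
  by rewrite lee_fin.
have setE t : [set w | (deviation w <= t%:E)%E] = [set w | X w - m <= t].
  by apply/seteqP; split => w /=; rewrite devE.
have tail lam v B t : 0 < lam -> lam * (K * z) <= alpha * tau / 2 -> 0 <= v -> 0 <= B ->
    B * lam < 1 ->
    (forall s : R, 0 < s -> s <= lam ->
      sigma ^+ 2 * expR (3 / 2 * (s * (K * z))) <= v / (1 - B * s) ^+ 2) ->
    x <= lam * t - v * lam ^+ 2 / (2 * (1 - B * lam)) ->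
    ((1 - expR (- x))%:E <= P [set w | (deviation w <= t%:E)%E])%E.
  move=> lam0 lamb v0 B0 Blam vB xt; rewrite setE.
  apply: (mgf_tail mX lam0 _ xt); apply: (mgf_clip_limit mX iX) => M M0.
  rewrite zE in lamb vB.
  exact: (clip_log_mgf_le a1 indepY mf defined orl var K0 t4 tauU maxK sumU sumS lam0 lamb v0 B0 Blam vB M0).
(* Both bounds are derived with [2 x] under the root and relaxed through [1 <= r]. *)
have sqr_le : Num.sqrt (2 * x) <= Num.sqrt (2 * x * r).
  by rewrite ler_wsqrtr// ler_peMr// mulr_ge0// ltW.
have sqs : sigma * Num.sqrt (2 * x) <= sigma * Num.sqrt (2 * x * r).
  by rewrite ler_wpM2l// ltW.
have Kzx0 : 0 < K * z * x by rewrite mulr_gt0.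
have bernstein t : sigma * Num.sqrt (2 * x) + 3 / 4 * (K * z) * x <= t ->
    ((1 - expR (- x))%:E <= P [set w | (deviation w <= t%:E)%E])%E.
  move=> /(bernstein_parameter s0 b0 x0) [lam [lam0 Blam xt]].
  apply: (tail lam (sigma ^+ 2) (3 / 4 * (K * z)) t) => //.
  - by lra.
  - exact: sqr_ge0.
  - by rewrite mulr_ge0// ltW.
  - move=> s s_gt0 sl; apply: bernstein_variance; first exact: ltW.
    apply: le_lt_trans Blam; rewrite ler_wpM2l// mulr_ge0// ltW//.
split; last first.
  apply: bernstein; rewrite lerD//.
  have -> : 3 / 4 * K * z * x * r = 3 / 4 * (K * z) * x * r by ring.
  by rewrite ler_peMr// mulr_ge0 ?(ltW x0)// mulr_ge0// ltW.
set D := Num.min _ _.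
have D1 : 1 <= D.
  rewrite le_min zalpha; apply/andP; split; first by nra.
  by rewrite le_max lexx orbT.
(* For [D <= 16 / 3], [4 / D >= 3 / 4] and the Bernstein bound suffices. *)
have [D16|D16] := leP D (16 / 3).
  apply: bernstein; rewrite lerD// ler_pdivlMr ?(lt_le_trans ltr01)//.
  have -> : 4 * K * z * x = 4 * (K * z * x) by ring.
  have -> : 3 / 4 * (K * z) * x * D = 3 / 4 * D * (K * z * x) by ring.
  by rewrite ler_wpM2r ?(ltW Kzx0)//; lra.
have D0 : 0 < D := lt_le_trans ltr01 D1.
have D2t : D <= 2 * alpha * tau by rewrite -zalpha ge_min lexx.
(* As [D > 16 / 3], the second entry of the minimum exceeds [1], so [ln1] is the logarithm there and
   can be exponentiated. *)
have Dln : expR D <= (K * z / (sigma * r)) ^+ 2 * x.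
  have : D <= ln1 ((K * z / (sigma * r)) ^+ 2 * x) by rewrite ge_min lexx orbT.
  rewrite /ln1 le_max => /orP[|]; last by lra.
  move=> h; rewrite -[leRHS]lnK ?posrE ?ler_expR//.
  by rewrite mulr_gt0// exprn_gt0// divr_gt0// mulr_gt0//; lra.
have hD : sigma * expR (D / 2) <= K * z * Num.sqrt x.
  have h1 : expR (D / 2) <= K * z / (sigma * r) * Num.sqrt x.
    rewrite -(ler_pXn2r (ltn0Sn 1)) ?nnegrE ?expR_ge0//.
      rewrite exprMn sqr_sqrtr ?(ltW x0)// expr2 -expRD.
      by rewrite (_ : D / 2 + D / 2 = D)//; lra.
    by rewrite mulr_ge0 ?sqrtr_ge0// divr_ge0 ?(ltW b0)// mulr_ge0//; lra.
  apply: le_trans (ler_wpM2l (ltW s0) h1) _.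
  have -> : sigma * (K * z / (sigma * r) * Num.sqrt x) = K * z * Num.sqrt x / r.
    by field; rewrite !gt_eqF//; lra.
  by rewrite ler_pdivrMr ?(lt_le_trans ltr01)// ler_peMr// mulr_ge0 ?sqrtr_ge0// ltW.
(* Here [lam b = D / 4], and [D <= 2 alpha tau] is exactly the cap [lam b <= alpha tau / 2]. *)
apply: (tail (D / 4 / (K * z)) (sigma ^+ 2 * expR (3 / 2 * (D / 4))) 0) => //.
- by rewrite divr_gt0// divr_gt0.
- by rewrite divfK ?gt_eqF//; lra.
- by rewrite mulr_ge0 ?sqr_ge0 ?expR_ge0.
- by rewrite mul0r.
- move=> s s_gt0 sl; rewrite mul0r subr0 expr1n divr1 ler_wpM2l ?sqr_ge0// ler_expR.
  by rewrite ler_wpM2l// -ler_pdivlMr.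
- apply: bennett_parameter => //.
  by rewrite lerD//; have -> : 4 * (K * z) = 4 * K * z by ring.
Qed.
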